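(* Let $n\ge2$, $m\ge2$. The $m-1$ cluster $R$-matrices $\tilde R_{M_1},\dots,\tilde R_{M_{m-1}}:\tilde{\mathcal{F}}\to\tilde{\mathcal{F}}$ satisfy $\tilde R_{M_i}\tilde R_{M_{i+1}}\tilde R_{M_i}=\tilde R_{M_{i+1}}\tilde R_{M_i}\tilde R_{M_{i+1}}$ for $1\le i\le m-2$ and $\tilde R_{M_i}^2=\mathrm{id}$ for $1\le i\le m-1$. Furthermore, $\tilde R_{M_i}\tilde R_{M_j}=\tilde R_{M_j}\tilde R_{M_i}$ whenever $|i-j|>1$. Thus the $\tilde R_{M_i}$ generate an action of the symmetric group $\mathfrak{S}_m$ on $\tilde{\mathcal{F}}$.
   Context: All second indices are taken in $\mathbb{Z}/n\mathbb{Z}$. Consider the triangular grid with vertices $(j,i)$, $0\le j\le m$, $i\in\mathbb{Z}/n\mathbb{Z}$, and arrows $(j,i)\to(j,i+1)$ for $0\le j\le m$; $(j,i)\to(j-1,i)$ for $1\le j\le m$; $(j,i)\to(j+1,i-1)$ for $0\le j\le m-1$. Let $M_j=\{(j,i)\}_{i}$. To each vertex attach a variable $x_{j,i}$ and to each arrow $a\to a'$ a (frozen) variable $X_{a,a'}$; $\tilde{\mathcal{F}}$ is the field of rational functions over $\mathbb{Q}$ in all these variables. Fix $1\le j\le m-1$, and abbreviate $i=(j,i)$, $i^-=(j-1,i)$, $i^+=(j+1,i)$, $x_i=x_{j,i}$, $x_i^-=x_{j-1,i}$, $x_i^+=x_{j+1,i}$. The cluster $R$-matrix $\tilde R_{M_j}:\tilde{\mathcal{F}}\to\tilde{\mathcal{F}}$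 is the rational transformation (field homomorphism) with $$\tilde R_{M_j}(x_i)=\frac{1}{\prod_{h\ne i}x_h}\sum_{l=i}^{i+n-1}x_{l+1}^-\Big(\prod_{h\in(\mathbb{Z}/n\mathbb{Z})\setminus\{l,l+1\}}x_h\Big)x_l^+\,X_{l,l+1}\Big(\prod_{h=l+1}^{i+n-1}X_{h^+,h}X_{(h+1)^-,h}\Big)\Big(\prod_{h=i+1}^{l}X_{h,h^-}X_{h,(h-1)^+}\Big)$$ (here $i,l,h$ in the sum and last two products are integers, reduced mod $n$ when used as indices; empty products are $1$), $$\tilde R_{M_j}(X_{i^+,i})=X_{i+1,(i+1)^-},\quad\tilde R_{M_j}(X_{i+1,(i+1)^-})=X_{i^+,i},\quad\tilde R_{M_j}(X_{i,(i-1)^+})=X_{i^-,i-1},\quad\tilde R_{M_j}(X_{i^-,i-1})=X_{i,(i-1)^+},$$ and fixing all other variables. Products denote composition. *)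

(* Defs.v *)
From mathcomp Require Import all_boot all_order all_algebra.
From mathcomp Require Import mpoly.

Set Implicit Arguments.
Unset Strict Implicit.
Unset Printing Implicit Defensive.

Import GRing.Theory.
Local Open Scope ring_scope.

Section ClusterR.

(* The second coordinate lives in 'Z_n, which is Z/nZ only for 1 < n. *)
Variables m n : nat.

Definition vertex : finType := ('I_m.+1 * 'Z_n)%type.

Definition arrow (a b : vertex) : bool :=
  [|| (b.1 == a.1 :> nat) && (b.2 == a.2 + 1),
      (b.1.+1 == a.1 :> nat) && (b.2 == a.2)
    | (b.1 == a.1.+1 :> nat) && (b.2 == a.2 - 1)].

(* One variable x_a per vertex and one variable X_(a,b) per arrow a -> b. *)
Definition var : finType :=
  (vertex + {p : vertex * vertex | arrow p.1 p.2})%type.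

Definition ratfun : fieldType := {fraction {mpoly rat[#|var|]}}.

Definition gen (v : var) : ratfun := tofrac 'X_(enum_rank v).

Definition evalp (y : var -> ratfun) (p : {mpoly rat[#|var|]}) : ratfun :=
  mmap (@tofrac _ \o @mpolyC #|var| rat) (fun k => y (enum_val k)) p.

(* Substitution of y v for each variable v, computed on some
   representative of the fraction f.  It is independent of the representative,
   and a field homomorphism, when no nonzero polynomial vanishes at y. *)
Definition subst (y : var -> ratfun) (f : ratfun) : ratfun :=
  evalp y \n_(repr f) / evalp y \d_(repr f).

Definition vtx (j : nat) (i : 'Z_n) : vertex := (inord j, i).

Definition xvar (j : nat) (i : 'Z_n) : ratfun := gen (inl (vtx j i)).

(* The value 0 on pairs that are not arrows is junk. *)
Definition Xvar (a b : vertex) : ratfun :=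
  if insub (a, b) is Some e then gen (inr e) else 0.

(* Image of x_(j,i).  The naturals l and h are the integer indices of the
   formula, starting from the representative of i in [0, n). *)
Definition Rx (j : nat) (i : 'Z_n) : ratfun :=
  (\prod_(h : 'Z_n | h != i) xvar j h)^-1 *
  \sum_(i <= l < i + n)
     xvar j.-1 l.+1%:R
     * (\prod_(h : 'Z_n | (h != l%:R) && (h != l.+1%:R)) xvar j h)
     * xvar j.+1 l%:R
     * Xvar (vtx j l%:R) (vtx j l.+1%:R)
     * (\prod_(l.+1 <= h < i + n)
          (Xvar (vtx j.+1 h%:R) (vtx j h%:R)
           * Xvar (vtx j.-1 h.+1%:R) (vtx j h%:R)))
     * (\prod_(i.+1 <= h < l.+1)
          (Xvar (vtx j h%:R) (vtx j.-1 h%:R)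
           * Xvar (vtx j h%:R) (vtx j.+1 (h%:R - 1)))).

(* Image of X_(a,b).  The direction of an arrow between different levels is
   read off from the levels of its end points. *)
Definition RX (j : nat) (a b : vertex) : ratfun :=
  let i := a.2 in
  if (a.1 == j.+1 :> nat) && (b.1 == j :> nat) then
    Xvar (vtx j (i + 1)) (vtx j.-1 (i + 1))
  else if (a.1 == j :> nat) && (b.1.+1 == j :> nat) then
    Xvar (vtx j.+1 (i - 1)) (vtx j (i - 1))
  else if (a.1 == j :> nat) && (b.1 == j.+1 :> nat) then
    Xvar (vtx j.-1 i) (vtx j (i - 1))
  else if (a.1.+1 == j :> nat) && (b.1 == j :> nat) then
    Xvar (vtx j i) (vtx j.+1 (i - 1))
  else Xvar a b.

Definition Rvar (j : nat) (v : var) : ratfun :=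
  match v with
  | inl a => if a.1 == j :> nat then Rx j a.2 else gen v
  | inr e => RX j (val e).1 (val e).2
  end.

(* The cluster R-matrix of M_j, for 0 < j < m. *)
Definition clusterR (j : nat) : ratfun -> ratfun := subst (Rvar j).

Definition field_hom (f : ratfun -> ratfun) : Prop :=
  zmod_morphism f /\ monoid_morphism f.

(* clusterR j is the only candidate for a field homomorphism with the
   prescribed values on the variables. *)
Lemma clusterR_unique (j : nat) (f : {rmorphism ratfun -> ratfun}) :
  (forall v, f (gen v) = Rvar j v) -> f =1 clusterR j.
Proof.
move=> fE.
pose c0 : {rmorphism rat -> ratfun} := @tofrac _ \o @mpolyC #|var| rat.
have fC c : f (c0 c) = c0 c.
  rewrite -[c]divq_num_den !fmorph_div.
  by rewrite !rmorph_int.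
have fp p : f (tofrac p) = evalp (Rvar j) p.
  elim/mpolyind: p => [|c mm p _ _ IH]; first by rewrite /evalp !raddf0.
  rewrite /evalp mmapD 2!rmorphD /= IH; congr (_ + _).
  rewrite -mul_mpolyC !rmorphM /= mmapC; congr (_ * _); first exact: fC.
  rewrite mmapX mpolyXE_id !rmorph_prod; apply: eq_bigr => i _.
  by rewrite !rmorphXn /= -fE /gen enum_valK.
move=> g; rewrite /clusterR /subst -!fp -fmorph_div; congr (f _).
rewrite -[LHS]reprK; set r := repr g.
apply/(canRL (mulfK _)); first by rewrite tofrac_eq0 denom_ratioP.
unlock FracField.tofrac; rewrite !piE.
apply/eqP; rewrite FracField.equivf_def /FracField.mulf.
by rewrite !numden_Ratio ?mulf_neq0 ?oner_eq0 ?denom_ratioP // !mulr1 mulrC.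
Qed.

Lemma X_arrow (e : {p : vertex * vertex | arrow p.1 p.2}) :
  Xvar (val e).1 (val e).2 = gen (inr e).
Proof.
by rewrite /Xvar; case: e => -[a b] /= ab; rewrite insubT.
Qed.

(* The images of the variables, in the notation xvar, Xvar. *)
Section Values.
Variables (j : nat) (f : ratfun -> ratfun).
Hypotheses (j_gt0 : (0 < j)%N) (ltjm : (j < m)%N).
Hypothesis fE : forall v, f (gen v) = Rvar j v.

Let val_vtx k i : (k <= m)%N -> (vtx k i).1 = k :> nat.
Proof. by move=> lekm; rewrite inordK. Qed.

Let fX a b : arrow a b -> f (Xvar a b) = RX j a b.
Proof. by move=> ab; rewrite /Xvar insubT fE. Qed.

Let lej1m : (j.-1 <= m)%N. Proof. by case: j ltjm => //= k /ltnW/ltnW. Qed.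

Lemma value_x i : f (xvar j i) = Rx j i.
Proof. by rewrite /xvar fE /= inordK ?eqxx // ltnS ltnW. Qed.

Lemma value_x_other k i : (k <= m)%N -> k != j -> f (xvar k i) = xvar k i.
Proof. by move=> lekm /negPf njk; rewrite /xvar fE /= inordK // njk. Qed.

Lemma value_X_down_above i :
  f (Xvar (vtx j.+1 i) (vtx j i)) = Xvar (vtx j (i + 1)) (vtx j.-1 (i + 1)).
Proof.
have e1 := val_vtx i ltjm; have e2 := val_vtx i (ltnW ltjm).
rewrite fX; first by rewrite /RX e1 e2 !eqxx.
by rewrite /arrow e1 e2 !eqxx orbT.
Qed.

Lemma value_X_down_below i :
  f (Xvar (vtx j (i + 1)) (vtx j.-1 (i + 1))) = Xvar (vtx j.+1 i) (vtx j i).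
Proof.
have e1 := val_vtx (i + 1) lej1m; have e2 := val_vtx (i + 1) (ltnW ltjm).
rewrite fX; last by rewrite /arrow e1 e2 prednK // !eqxx orbT.
by rewrite /RX e1 e2 prednK // ltn_eqF // !eqxx /= addrK.
Qed.

Lemma value_X_up_above i :
  f (Xvar (vtx j i) (vtx j.+1 (i - 1))) = Xvar (vtx j.-1 i) (vtx j (i - 1)).
Proof.
have e1 := val_vtx (i - 1) ltjm; have e2 := val_vtx i (ltnW ltjm).
rewrite fX; last by rewrite /arrow e1 e2 !eqxx !orbT.
by rewrite /RX e1 e2 !eqxx ltn_eqF // (@gtn_eqF j j.+2) // ltnS leqnSn.
Qed.

Lemma value_X_up_below i :
  f (Xvar (vtx j.-1 i) (vtx j (i - 1))) = Xvar (vtx j i) (vtx j.+1 (i - 1)).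
Proof.
have e1 := val_vtx i lej1m; have e2 := val_vtx (i - 1) (ltnW ltjm).
rewrite fX; last by rewrite /arrow e1 e2 prednK // !eqxx !orbT.
have lt1 : (j.-1 < j)%N by rewrite prednK.
by rewrite /RX e1 e2 prednK // !eqxx (ltn_eqF lt1) ltn_eqF // ltnS leq_pred.
Qed.

Lemma value_X_other (a b : vertex) : arrow a b ->
  (a.1 == b.1) || ((a.1 != j :> nat) && (b.1 != j :> nat)) ->
  f (Xvar a b) = Xvar a b.
Proof.
move=> ab nj; rewrite fX // /RX.
case/orP: nj => [/eqP eab | /andP[/negPf -> /negPf ->]]; last by rewrite !andbF.
rewrite eab; have [->|_] := eqVneq (b.1 : nat) j; last by rewrite !andbF.
by rewrite eqn_leq ltnn andbF gtn_eqF //= ltn_eqF.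
Qed.

End Values.

End ClusterR.

(* Main.v *)
Require Import Defs.
From HB Require Import structures.
From mathcomp Require Import all_boot all_fingroup all_algebra.
From mathcomp Require Import all_order ring zify.
From mathcomp Require Import generic_quotient fraction mpoly.

(** Write d_k(i) and u_k(i) for the frozen variables on the arrows
    (k,i) -> (k-1,i) and (k-1,i) -> (k,i-1) of the strip between the levels
    k-1 and k.  Up to a shift of i, the R-matrix of M_j exchanges the families
    of the strips j and j+1, and on frozen variables it does nothing else.

    The value x' of the R-matrix on the row x = x_j is best described by an
    equation instead of the defining sum.  That sum telescopes (cyclic_sumP),
    which yields the bilinear relation
      d_{j+1}(i) u_j(i+1) x'(i) x(i+1) - d_j(i+1) u_{j+1}(i+1) x(i) x'(i+1)
         = D X_{i,i+1} x_{j-1}(i+1) x_{j+1}(i),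
    where D = prod d_{j+1} prod u_j - prod d_j prod u_{j+1}.  For given x this
    is a cyclic linear system in x' with determinant D, so x' is its only
    solution (bilinear_unique).  All identities between R-matrices follow by
    checking that both sides solve the same system.

    Exchanging x with x' and strip j with strip j+1 only changes the sign of
    the relation, hence R_j is an involution (Rform_involutive).

    For the braid relation, let t_S be the variable of level j-1+|S| once the
    strips below it are those in S, for S a subset of {1,2,3}: the strips
    involved in R_j and R_{j+1} are j, j+1, j+2.  The relations of R_j say
    that the 2x2 minors [ab], built from the vectors
    (u_a(i+1) t_a(i+1), d_a(i) t_a(i)) with d_a in its current position, are
    multiples of the t_ab(i).  The Pluecker identities
    [23] v_1 - [13] v_2 + [12] v_3 = 0 for the two coordinates v then show that
    the relations of four faces of the cube of subsets imply those of the
    other two (braid_bottom, braid_top).  So both orders of exchanging the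
    strips give the same t_3 and t_23 (braid_images).

    It remains to know that substitution in rational functions is a field
    homomorphism here, that is, that the images of the variables are
    algebraically independent.  The R-matrix can be evaluated at its own
    images, because its denominators are products of variables of the row j,
    whose images are nonzero.  By the involution property this returns the
    variables, so a polynomial that vanishes at the images is zero
    (Rvar_independent).

    Finally the braid, involution and commutation relations present the
    symmetric group: every word in the generators has a normal form, and the
    normal form can be read off from the permutation (swap_faithful). *)

Set Implicit Arguments.
Unset Strict Implicit.
Unset Printing Implicit Defensive.

Import Order.TTheory GRing.Theory Num.Theory.

(** * Partial evaluation of fractions *)

Section Specialization.
Local Open Scope ring_scope.

Variables (R : idomainType) (K : fieldType) (phi : {rmorphism R -> K}).

(** The graph of the extension of phi to the localization of R at its kernel.
    It is a relation because the extension is not defined on all fractions. *)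
Definition specializes (f : {fraction R}) (c : K) : Prop :=
  exists a b, [/\ phi b != 0, f = tofrac a / tofrac b & c = phi a / phi b].

Let tofrac_neq0 b : phi b != 0 -> tofrac b != 0.
Proof. by rewrite tofrac_eq0; apply: contraNneq => ->; rewrite rmorph0. Qed.

(** a / b = a' / b' means a b' = a' b, an identity that phi preserves. *)
Lemma specializes_unique f c c' :
  specializes f c -> specializes f c' -> c = c'.
Proof.
case=> a [b [bn0 -> ->]] [a' [b' [bn0' /eqP + ->]]].
rewrite eqr_div ?tofrac_neq0 // -!rmorphM tofrac_eq => /eqP eab.
by apply/eqP; rewrite eqr_div // -!rmorphM eab.
Qed.

Lemma specializes_tofrac a : specializes (tofrac a) (phi a).
Proof. by exists a, 1; split; rewrite !(rmorph1, divr1) ?oner_eq0. Qed.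

Lemma specializes1 : specializes 1 1.
Proof. by rewrite -(rmorph1 phi) -tofrac1; apply: specializes_tofrac. Qed.

Lemma specializes0 : specializes 0 0.
Proof. by rewrite -(rmorph0 phi) -tofrac0; apply: specializes_tofrac. Qed.

Lemma specializesM f g c d :
  specializes f c -> specializes g d -> specializes (f * g) (c * d).
Proof.
case=> a [b [bn0 -> ->]] [a' [b' [bn0' -> ->]]].
exists (a * a'), (b * b'); split; first by rewrite rmorphM mulf_neq0.
  by rewrite mulf_div !rmorphM.
by rewrite mulf_div !rmorphM.
Qed.

Lemma specializesD f g c d :
  specializes f c -> specializes g d -> specializes (f + g) (c + d).
Proof.
case=> a [b [bn0 -> ->]] [a' [b' [bn0' -> ->]]].
exists (a * b' + a' * b), (b * b'); split; first by rewrite rmorphM mulf_neq0.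
  by rewrite addf_div ?tofrac_neq0 // rmorphD !rmorphM.
by rewrite addf_div // rmorphD !rmorphM.
Qed.

Lemma specializesN f c : specializes f c -> specializes (- f) (- c).
Proof.
case=> a [b [bn0 -> ->]]; exists (- a), b.
by split; rewrite // rmorphN mulNr.
Qed.

Lemma specializesB f g c d :
  specializes f c -> specializes g d -> specializes (f - g) (c - d).
Proof. by move=> fc gd; apply/specializesD/specializesN. Qed.

Lemma specializesV f c : c != 0 -> specializes f c -> specializes f^-1 c^-1.
Proof.
move=> cn0 [a [b [bn0 -> cE]]]; exists b, a; split; last 2 first.
- by rewrite invf_div.
- by rewrite cE invf_div.
by apply: contraNneq cn0; rewrite cE => ->; rewrite mul0r.
Qed.

Lemma specializes_sum (I : Type) (r : seq I) (P : pred I) f c :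
  (forall i, P i -> specializes (f i) (c i)) ->
  specializes (\sum_(i <- r | P i) f i) (\sum_(i <- r | P i) c i).
Proof.
move=> fc; elim/big_rec2: _; first exact: specializes0.
by move=> i x y Pi; apply/specializesD/fc.
Qed.

Lemma specializes_prod (I : Type) (r : seq I) (P : pred I) f c :
  (forall i, P i -> specializes (f i) (c i)) ->
  specializes (\prod_(i <- r | P i) f i) (\prod_(i <- r | P i) c i).
Proof.
move=> fc; elim/big_rec2: _; first exact: specializes1.
by move=> i x y Pi; apply/specializesM/fc.
Qed.

(** The way to prove that a fraction is nonzero: exhibit one point where its
    value is. *)
Lemma specializes_neq0 f c : specializes f c -> c != 0 -> f != 0.
Proof.
move=> fc; apply: contraNneq => f0; rewrite f0 in fc.
by apply/eqP; apply: specializes_unique fc specializes0.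
Qed.

End Specialization.

Section FractionRepr.
Local Open Scope ring_scope.

Lemma fraction_numden (R : idomainType) (f : {fraction R}) :
  f = tofrac \n_(repr f) / tofrac \d_(repr f).
Proof.
rewrite -[LHS]reprK; set r := repr f.
apply/(canRL (mulfK _)); first by rewrite tofrac_eq0 denom_ratioP.
unlock FracField.tofrac; rewrite !piE.
apply/eqP; rewrite FracField.equivf_def /FracField.mulf.
by rewrite !numden_Ratio ?mulf_neq0 ?oner_eq0 ?denom_ratioP // !mulr1 mulrC.
Qed.

End FractionRepr.

(** * Homomorphisms between fields of rational functions *)

Section Substitution.
Local Open Scope ring_scope.
Variables m n : nat.
Notation F := (ratfun m n).
Notation poly := {mpoly rat[#|var m n|]}.

(** Gives access to the library of ring morphisms, which needs a bundled map. *)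
Lemma rmorphism_of_field_hom (f : F -> F) :
  field_hom f -> {g : {rmorphism F -> F} | g =1 f}.
Proof.
case=> fB fM.
pose fA := GRing.isZmodMorphism.Build _ _ f fB.
pose fR := GRing.isMonoidMorphism.Build _ _ f fM.
pose g : {rmorphism F -> F} := HB.pack f fA fR.
by exists g.
Qed.

Lemma evalp_hom (y : var m n -> F) : {g : {rmorphism poly -> F} | g =1 evalp y}.
Proof.
pose c0 : {rmorphism rat -> F} := @tofrac _ \o @mpolyC #|var m n| rat.
by exists (mmap c0 (fun k => y (enum_val k))).
Qed.

Lemma evalp_gen y v : evalp y ('X_(enum_rank v)) = y v :> F.
Proof. by rewrite /evalp mmapX mmap1U enum_rankK. Qed.

(** A field homomorphism fixes the rational constants, so it is determined on
    polynomials, hence on fractions, by its values on the variables. *)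
Lemma field_hom_ext (f g : F -> F) :
  field_hom f -> field_hom g -> (forall v, f (gen v) = g (gen v)) -> f =1 g.
Proof.
move=> /rmorphism_of_field_hom[f' fE] /rmorphism_of_field_hom[g' gE] efg.
pose c0 : {rmorphism rat -> F} := @tofrac _ \o @mpolyC #|var m n| rat.
have fgp p : f' (tofrac p) = g' (tofrac p).
  elim/mpolyind: p => [|c mm p _ _ IH]; first by rewrite !rmorph0.
  rewrite -mul_mpolyC !(rmorphD, rmorphM) /= IH; congr (_ * _ + _).
    rewrite -[c]divq_num_den.
    by rewrite -[LHS]/((f' \o c0) _) -[RHS]/((g' \o c0) _) !fmorph_div !rmorph_int.
  rewrite mpolyXE_id !rmorph_prod; apply: eq_bigr => i _.
  rewrite !rmorphXn; congr (_ ^+ _).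
  by rewrite -[i]enum_valK -/(gen _) fE gE efg.
by move=> x; rewrite -fE -gE [x]fraction_numden !fmorph_div !fgp.
Qed.

(** Independence makes evaluation at y injective, so every fraction has a
    value under it, and subst y computes this value whichever representative
    it picks. *)
Lemma subst_field_hom (y : var m n -> F) :
    (forall p : poly, evalp y p = 0 -> p = 0) ->
  field_hom (subst y) /\ forall v, subst y (gen v) = y v.
Proof.
have [phi phiE] := evalp_hom y => inj.
have phi_neq0 p : p != 0 -> phi p != 0.
  by apply: contraNneq; rewrite phiE => /inj ->.
have spec f : specializes phi f (subst y f).
  exists (\n_(repr f)), (\d_(repr f)); rewrite phi_neq0 ?denom_ratioP //.
  by rewrite /subst !phiE; split=> //; apply: fraction_numden.
split; last first.
  move=> v; apply: specializes_unique (spec _) _.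
  rewrite -[y v]evalp_gen -phiE; exact: specializes_tofrac.
split; first by move=> f g; apply/(specializes_unique (spec _))/specializesB.
split; last by move=> f g; apply/(specializes_unique (spec _))/specializesM.
by apply: specializes_unique (spec _) _; apply: specializes1.
Qed.

End Substitution.

(** * Cyclic linear recurrences *)

Section CyclicRecurrence.
Local Open Scope ring_scope.

Variables (n : nat) (n_gt1 : (1 < n)%N) (K : fieldType).
Implicit Types (A B c x z : 'Z_n -> K) (i : 'Z_n).

Lemma natr_modulus : n%:R = 0 :> 'Z_n. Proof. exact: pchar_Zp. Qed.

(** Walking n steps around Z/n from any starting point meets every residue
    once. *)
Lemma prod_from A i : \prod_(0 <= h < n) A (i + h%:R) = \prod_h A h.
Proof.
rewrite big_mkord [RHS](reindex (fun h => i + h)) /=; last first.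
  by exists (fun h => h - i) => h _; rewrite ?subrKC // addrC addKr.
case: n n_gt1 A i => [|[|k]] // _ A i.
by apply: eq_bigr => h _; rewrite natr_Zp.
Qed.

Lemma prod_succ A : \prod_h A (h + 1) = \prod_h A h.
Proof. by rewrite [RHS](reindex_inj (addIr 1)). Qed.

Lemma prod_pred A : \prod_h A (h - 1) = \prod_h A h.
Proof. by rewrite [RHS](reindex_inj (addIr (- 1))). Qed.

Lemma prod_shift A i a b :
  \prod_(a.+1 <= h < b.+1) A (i + h%:R) = \prod_(a <= h < b) A (i + 1 + h%:R).
Proof.
by rewrite big_add1; apply: eq_bigr => h _; rewrite -addrA nat1r.
Qed.

(** The sum over l = i, ..., i+n-1 in the definition of the R-matrix, indexed
    by s = l - i so that it visibly depends on i only modulo n. *)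
Definition cyclic_sum A B c i : K :=
  \sum_(0 <= s < n) c (i + s%:R) * \prod_(s.+1 <= h < n) A (i + h%:R)
                    * \prod_(1 <= h < s.+1) B (i + h%:R).

(** Multiplying by A i on the left and by B (i + 1) on the right completes both
    sums to pieces of the same sequence g, of n+1 terms, from which the first
    lacks the last term and the second the first one. *)
Lemma cyclic_sumP A B c i :
  A i * cyclic_sum A B c i - B (i + 1) * cyclic_sum A B c (i + 1)
  = c i * (\prod_h A h - \prod_h B h).
Proof.
(* The product of the A now includes h = n, whose factor is A i. *)
pose g s := c (i + s%:R) * \prod_(s.+1 <= h < n.+1) A (i + h%:R)
              * \prod_(1 <= h < s.+1) B (i + h%:R).
have g0 : g 0%N = c i * \prod_h A h.
  by rewrite /g addr0 [X in _ * X]big_geq // mulr1 -(prod_from A (i + 1)) prod_shift.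
have gn : g n = c i * \prod_h B h.
  rewrite /g natr_modulus addr0 [X in _ * X * _]big_geq // mulr1.
  by rewrite -(prod_from B (i + 1)) prod_shift.
rewrite mulrBr -g0 -gn -[RHS]opprB -telescope_sumr // sumrB opprB.
congr (_ - _); rewrite /cyclic_sum big_distrr /=; apply: eq_big_nat => s /andP[_ lt_sn].
  by rewrite /g [in RHS]big_nat_recr //= natr_modulus addr0; ring.
rewrite /g prod_shift [\prod_(1 <= h < s.+2) _]big_ltn // prod_shift -nat1r !addrA.
by ring.
Qed.

(** Once around the cycle, the recurrence multiplies z i by the ratio of the two
    products; both sides are kept as products because B may vanish. *)
Lemma cyclic_kernel A B z :
    \prod_h A h != \prod_h B h ->
    (forall i, A i * z i = B (i + 1) * z (i + 1)) ->
  forall i, z i = 0.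
Proof.
move=> neqAB eqz i.
have step k : \prod_(0 <= h < k) A (i + h%:R) * z i
    = \prod_(0 <= h < k) B (i + 1 + h%:R) * z (i + k%:R).
  elim: k => [|k IH]; first by rewrite !big_geq // addr0.
  rewrite !big_nat_recr //= mulrAC IH -natr1 [i + (_ + 1)]addrA.
  by rewrite -[RHS]mulrA [i + 1 + _]addrAC -eqz; ring.
apply/eqP; have /eqP := step n.
rewrite !prod_from natr_modulus addr0 -subr_eq0 -mulrBl mulf_eq0.
by rewrite subr_eq0 (negPf neqAB).
Qed.

(** For fixed x the equation is linear in x', and the substitution
    z = (x' - x'') / x turns its homogeneous form into the recurrence above. *)
Lemma bilinear_unique A B c x x' x'' :
    \prod_h A h != \prod_h B h -> (forall i, x i != 0) ->
    (forall i, A i * x' i * x (i + 1) - B (i + 1) * x i * x' (i + 1) = c i) ->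
    (forall i, A i * x'' i * x (i + 1) - B (i + 1) * x i * x'' (i + 1) = c i) ->
  x' =1 x''.
Proof.
move=> neqAB xn0 ex' ex'' i; apply/eqP; rewrite -subr_eq0.
suff /eqP : (x' i - x'' i) / x i = 0 by rewrite mulf_eq0 invr_eq0 (negPf (xn0 i)) orbF.
apply: (cyclic_kernel neqAB (z := fun i => (x' i - x'' i) / x i)) => k.
rewrite !mulrA; apply/eqP; rewrite eqr_div //; apply/eqP.
have := ex' k; rewrite -(ex'' k) => /eqP; rewrite -subr_eq0 => /eqP e.
by apply/eqP; rewrite -subr_eq0 -e; apply/eqP; ring.
Qed.

End CyclicRecurrence.

(** * The sum defining the R-matrix *)

Section RForm.
Local Open Scope ring_scope.

Variables (n : nat) (n_gt1 : (1 < n)%N) (K : fieldType).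
Implicit Types (A B e x xm xp : 'Z_n -> K) (i : 'Z_n).

(** The R-matrix over an arbitrary field: x is the mutated row, xm and xp the
    rows below and above, e the variables on the arrows inside the row, and
    A, B the products of frozen variables in the two inner products.  Factoring
    out x i leaves terms that do not depend on i. *)
Definition Rform xm x xp e A B i : K :=
  x i * cyclic_sum A B (fun l => e l * xm (l + 1) * xp l / (x l * x (l + 1))) i.

(** Matches a term of the defining formula, which has the products over
    h != i and over h != l, l + 1, with a term of the factored form. *)
Lemma Rform_term xm x xp e i l : (forall h, x h != 0) ->
  (\prod_(h | h != i) x h)^-1
    * (xm (l + 1) * \prod_(h | (h != l) && (h != l + 1)) x h * xp l * e l)
  = x i * (e l * xm (l + 1) * xp l / (x l * x (l + 1))).
Proof.
move=> xn0.
have el : \prod_h x h = x l * x (l + 1)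
    * \prod_(h | (h != l) && (h != l + 1)) x h.
  rewrite (bigD1 l) //= (bigD1 (l + 1)) /= ?mulrA //.
  by rewrite -subr_eq0 addrAC subrr add0r oner_eq0.
have p_neq0 (P : pred 'Z_n) : \prod_(h | P h) x h != 0.
  by apply/prodf_neq0 => h _; apply: xn0.
have := el; rewrite (bigD1 i) //= => /(canRL (mulKf (xn0 _))) ->.
by field; rewrite !xn0 p_neq0.
Qed.

Lemma eq_Rform xm x xp e A B xm' x' xp' e' A' B' :
    xm =1 xm' -> x =1 x' -> xp =1 xp' -> e =1 e' -> A =1 A' -> B =1 B' ->
  Rform xm x xp e A B =1 Rform xm' x' xp' e' A' B'.
Proof.
move=> em ex ep ee eA eB i; rewrite /Rform /cyclic_sum ex; congr (_ * _).
apply: eq_bigr => s _; rewrite !(em, ex, ep, ee); congr (_ * _ * _).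
  by apply: eq_bigr => h _.
by apply: eq_bigr => h _.
Qed.

Lemma Rform_bilinear xm x xp e A B i : (forall k, x k != 0) ->
  A i * Rform xm x xp e A B i * x (i + 1)
    - B (i + 1) * x i * Rform xm x xp e A B (i + 1)
  = e i * xm (i + 1) * xp i * (\prod_h A h - \prod_h B h).
Proof.
move=> xn0; rewrite /Rform; set c := fun l => _.
transitivity (x i * x (i + 1)
    * (A i * cyclic_sum A B c i - B (i + 1) * cyclic_sum A B c (i + 1))).
  by ring.
rewrite cyclic_sumP // /c.
by field; rewrite !xn0.
Qed.

(** Applying the R-matrix exchanges the roles of A and B up to a shift.  With
    x' in the place of x, the relation for the next image is solved by x
    itself: it is the same relation up to sign. *)
Lemma Rform_involutive xm x xp e A B :
    \prod_h A h != \prod_h B h ->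
    (forall i, x i != 0) -> (forall i, Rform xm x xp e A B i != 0) ->
  Rform xm (Rform xm x xp e A B) xp e (fun h => B (h + 1)) (fun h => A (h - 1))
    =1 x.
Proof.
move=> neqAB xn0; set x' := Rform _ x _ _ _ _ => xn0'.
have eB := prod_succ B; have eA := prod_pred A.
apply: (@bilinear_unique n _ K (fun h => B (h + 1)) (fun h => A (h - 1))
  (fun i => e i * xm (i + 1) * xp i * (\prod_h B h - \prod_h A h)) x') => //.
- by rewrite eA eB eq_sym.
- by move=> i; rewrite Rform_bilinear // eA eB.
move=> i; rewrite addrK -[\prod_h B h - _]opprB mulrN.
by rewrite -(Rform_bilinear xm xp e A B i xn0) -/x'; ring.
Qed.

End RForm.

Section SpecializeRForm.
Local Open Scope ring_scope.

Lemma map_Rform (n : nat) (K L : fieldType) (f : {rmorphism K -> L})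
    (xm x xp e A B : 'Z_n -> K) i :
  f (Rform xm x xp e A B i)
  = Rform (f \o xm) (f \o x) (f \o xp) (f \o e) (f \o A) (f \o B) i.
Proof.
rewrite /Rform /cyclic_sum rmorphM rmorph_sum; congr (_ * _).
by apply: eq_bigr => s _; rewrite !rmorphM fmorphV rmorphM !rmorph_prod.
Qed.

Variables (n : nat) (R : idomainType) (K : fieldType).
Variable phi : {rmorphism R -> K}.

Lemma specializes_Rform (xm x xp e A B : 'Z_n -> {fraction R})
    (xm' x' xp' e' A' B' : 'Z_n -> K) :
    (forall i, x' i != 0) ->
    (forall i, specializes phi (xm i) (xm' i)) ->
    (forall i, specializes phi (x i) (x' i)) ->
    (forall i, specializes phi (xp i) (xp' i)) ->
    (forall i, specializes phi (e i) (e' i)) ->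
    (forall i, specializes phi (A i) (A' i)) ->
    (forall i, specializes phi (B i) (B' i)) ->
  forall i, specializes phi (Rform xm x xp e A B i) (Rform xm' x' xp' e' A' B' i).
Proof.
move=> xn0 sm sx sp se sA sB i.
apply: specializesM; first exact: sx.
apply: specializes_sum => s _; apply: specializesM.
  apply: specializesM; last exact: specializes_prod.
  apply: specializesM; first by apply/specializesM/sp/specializesM/sm.
  by apply: specializesV; [rewrite mulf_neq0 | apply: specializesM].
exact: specializes_prod.
Qed.

End SpecializeRForm.

(** * Bilinear relations on the cube of subsets *)

Section BilinearRelation.
Local Open Scope ring_scope.

Variables (n : nat) (K : fieldType).

Definition shift (d : 'Z_n -> K) i := d (i + 1).

(** The relation of the square with corners t = t_S, ta = t_(S+a), tb = t_(S+b)
    and tab = t_(S+a+b), where Da, Ua and Db, Ub are the frozen variables of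
    the strips a and b in their current position. *)
Definition bilinear_relation (Da Db Ua Ub : 'Z_n -> K) (D : K)
    (e ta tb t tab : 'Z_n -> K) : Prop :=
  forall i, Db i * Ua (i + 1) * tb i * ta (i + 1)
            - Da i * Ub (i + 1) * ta i * tb (i + 1)
            = e i * t (i + 1) * tab i * D.

(** The hypothesis on products says that the cyclic linear system for tb has a
    nonzero determinant. *)
Lemma relation_unique Da Db Ua Ub D e ta tb tb' t tab : (1 < n)%N ->
    \prod_h Db h * \prod_h Ua h != \prod_h Da h * \prod_h Ub h ->
    (forall i, ta i != 0) ->
    bilinear_relation Da Db Ua Ub D e ta tb t tab ->
    bilinear_relation Da Db Ua Ub D e ta tb' t tab ->
  tb =1 tb'.
Proof.
move=> n_gt1 neqD tan0 rb rb'.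
apply: (@bilinear_unique n n_gt1 K (fun i => Db i * Ua (i + 1))
  (fun i => Da (i - 1) * Ub i) (fun i => e i * t (i + 1) * tab i * D) ta) => // [|i|i];
  last 2 first.
- by rewrite addrK rb.
- by rewrite addrK rb'.
rewrite !big_split /= prod_succ -(prod_succ (fun h => Da (h - 1))).
by under [X in _ != X * _]eq_bigr => h _ do rewrite addrK.
Qed.

Lemma relation_map (f : {rmorphism K -> K}) Da Db Ua Ub D e ta tb t tab
    Da' Db' Ua' Ub' D' e' ta' tb' t' tab' :
    bilinear_relation Da Db Ua Ub D e ta tb t tab ->
    f \o Da =1 Da' -> f \o Db =1 Db' -> f \o Ua =1 Ua' -> f \o Ub =1 Ub' ->
    f D = D' -> f \o e =1 e' -> f \o ta =1 ta' -> f \o tb =1 tb' ->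
    f \o t =1 t' -> f \o tab =1 tab' ->
  bilinear_relation Da' Db' Ua' Ub' D' e' ta' tb' t' tab'.
Proof.
move=> r eDa eDb eUa eUb <- ee eta etb et etab i.
have := congr1 f (r i); rewrite rmorphB !rmorphM.
by rewrite -eDa -eDb -!eUa -!eUb -ee -!eta -!etb -et -etab.
Qed.

End BilinearRelation.

Section Braid.
Local Open Scope ring_scope.

Variables (n : nat) (n_gt1 : (1 < n)%N) (K : fieldType).

(* The strips 1, 2, 3 with their variables t_S; d_a is normalized so that
   moving the strip up by one position shifts it once. *)
Variables d1 d2 d3 u1 u2 u3 e1 e2 : 'Z_n -> K.
Variables t0 t1 t2 t3 t12 t13 t23 t123 : 'Z_n -> K.
Variables D12 D13 D23 : K.

Hypotheses (e1_neq0 : forall i, e1 i != 0) (t0_neq0 : forall i, t0 i != 0).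
Hypotheses (t2_neq0 : forall i, t2 i != 0) (t12_neq0 : forall i, t12 i != 0).
Hypotheses (D13_neq0 : D13 != 0).
Hypothesis norms23_neq :
  (\prod_h d3 h) * (\prod_h u2 h) != (\prod_h d2 h) * (\prod_h u3 h).

Hypothesis r12_0 : bilinear_relation (shift d1) (shift d2) u1 u2 D12 e1 t1 t2 t0 t12.
Hypothesis r23_0 : bilinear_relation (shift d2) (shift d3) u2 u3 D23 e1 t2 t3 t0 t23.
Hypothesis r13_2 :
  bilinear_relation (shift (shift d1)) (shift (shift d3)) u1 u3 D13 e2 t12 t23 t2 t123.
Hypothesis r23_1 :
  bilinear_relation (shift (shift d2)) (shift (shift d3)) u2 u3 D23 e2 t12 t13 t1 t123.

(* The value of t_13 that makes the relation of the face (13|0) true by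
   definition; it is identified with t_13 below. *)
Let s13 i :=
  (d3 (i + 1) * u1 (i + 1) * t3 i * t1 (i + 1)
   - d1 (i + 1) * u3 (i + 1) * t1 i * t3 (i + 1)) / (e1 i * t0 (i + 1) * D13).

Let s13P : bilinear_relation (shift d1) (shift d3) u1 u3 D13 e1 t1 t3 t0 s13.
Proof.
by move=> i; rewrite /s13 /shift; field; rewrite D13_neq0 t0_neq0 e1_neq0.
Qed.

(* The Pluecker relations between the minors of the faces (12|0), (13|0) and
   (23|0), divided by the common factor e1 i * t0 (i + 1). *)
Let pluecker_u i : u1 (i + 1) * t1 (i + 1) * D23 * t23 i
  - u2 (i + 1) * t2 (i + 1) * D13 * s13 i
  + u3 (i + 1) * t3 (i + 1) * D12 * t12 i = 0.
Proof.
apply: (mulfI (mulf_neq0 (e1_neq0 i) (t0_neq0 (i + 1)))); rewrite mulr0.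
transitivity (u1 (i + 1) * t1 (i + 1) * (e1 i * t0 (i + 1) * t23 i * D23)
   - u2 (i + 1) * t2 (i + 1) * (e1 i * t0 (i + 1) * s13 i * D13)
   + u3 (i + 1) * t3 (i + 1) * (e1 i * t0 (i + 1) * t12 i * D12)); first by ring.
by rewrite -r12_0 -r23_0 -s13P; ring.
Qed.

Let pluecker_d i : d1 (i + 1) * t1 i * D23 * t23 i
  - d2 (i + 1) * t2 i * D13 * s13 i
  + d3 (i + 1) * t3 i * D12 * t12 i = 0.
Proof.
apply: (mulfI (mulf_neq0 (e1_neq0 i) (t0_neq0 (i + 1)))); rewrite mulr0.
transitivity (d1 (i + 1) * t1 i * (e1 i * t0 (i + 1) * t23 i * D23)
   - d2 (i + 1) * t2 i * (e1 i * t0 (i + 1) * s13 i * D13)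
   + d3 (i + 1) * t3 i * (e1 i * t0 (i + 1) * t12 i * D12)); first by ring.
by rewrite -r12_0 -r23_0 -s13P /shift; ring.
Qed.

(* s13 solves the relation of the face (23|1) because the terms with t3 cancel
   between the Pluecker relations at i and i + 1, and the rest is the face
   (13|2). *)
Let t13E : t13 =1 s13.
Proof.
apply: (relation_unique n_gt1 _ t12_neq0 r23_1); first by rewrite !prod_succ.
move=> i; apply: (mulfI (mulf_neq0 D13_neq0 (t2_neq0 (i + 1)))).
transitivity (D23 * t1 (i + 1) * (e2 i * t2 (i + 1) * t123 i * D13)); last by ring.
(* Each rewriting of a 0 adds a multiple of a Pluecker expression. *)
rewrite -r13_2 /shift -[LHS]addr0 -[X in _ + X](mulr0 (d3 (i + 1 + 1) * t12 (i + 1))).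
rewrite -(pluecker_u i) -[RHS]addr0.
rewrite -[X in _ = _ + X](mulr0 (u3 (i + 1) * t12 i)) -(pluecker_d (i + 1)).
by ring.
Qed.

Lemma braid_bottom : bilinear_relation (shift d1) (shift d3) u1 u3 D13 e1 t1 t3 t0 t13.
Proof. by move=> i; rewrite t13E s13P. Qed.

(** The same two Pluecker relations, combined so that the terms with t1 cancel
    instead of those with t3. *)
Lemma braid_top :
  bilinear_relation (shift (shift d1)) (shift (shift d2)) u1 u2 D12 e2 t13 t23 t3 t123.
Proof.
move=> i; rewrite !t13E; apply: (mulfI (mulf_neq0 D13_neq0 (t2_neq0 (i + 1)))).
transitivity (D12 * t3 (i + 1) * (e2 i * t2 (i + 1) * t123 i * D13)); last by ring.
rewrite -r13_2 /shift -[LHS]addr0 -[X in _ + X](mulr0 (u1 (i + 1) * t23 i)).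
rewrite -(pluecker_d (i + 1)) -[RHS]addr0.
rewrite -[X in _ = _ + X](mulr0 (d1 (i + 1 + 1) * t23 (i + 1))) -(pluecker_u i).
by ring.
Qed.

End Braid.

(** * The braid relation for abstract homomorphisms *)

Section BraidRelation.
Local Open Scope ring_scope.

Variables (n : nat) (n_gt1 : (1 < n)%N) (K : fieldType).
(* T and U stand for the R-matrices of the levels j and j + 1, and x0, ..., x3
   for the rows j - 1, ..., j + 2.  Up to normalization they permute the three
   strips, as the transpositions (1 2) and (2 3). *)
Variables T U : {rmorphism K -> K}.
Variables d1 d2 d3 u1 u2 u3 e1 e2 x0 x1 x2 x3 : 'Z_n -> K.

Local Notation N d := (\prod_h d h).
Local Notation D12 := (N d2 * N u1 - N d1 * N u2).
Local Notation D13 := (N d3 * N u1 - N d1 * N u3).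
Local Notation D23 := (N d3 * N u2 - N d2 * N u3).

Hypotheses (e1_neq0 : forall i, e1 i != 0) (D12_neq0 : D12 != 0).
Hypotheses (x0_neq0 : forall i, x0 i != 0) (x1_neq0 : forall i, x1 i != 0).
Hypotheses (x2_neq0 : forall i, x2 i != 0).

Hypotheses (Td1 : T \o d1 =1 d2) (Td2 : T \o d2 =1 d1) (Td3 : T \o d3 =1 d3).
Hypotheses (Tu1 : T \o u1 =1 u2) (Tu2 : T \o u2 =1 u1) (Tu3 : T \o u3 =1 u3).
Hypotheses (Te1 : T \o e1 =1 e1) (Te2 : T \o e2 =1 e2).
Hypotheses (Tx0 : T \o x0 =1 x0) (Tx2 : T \o x2 =1 x2) (Tx3 : T \o x3 =1 x3).
Hypotheses (Ud1 : U \o d1 =1 d1) (Ud2 : U \o d2 =1 d3) (Ud3 : U \o d3 =1 d2).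
Hypotheses (Uu1 : U \o u1 =1 u1) (Uu2 : U \o u2 =1 u3) (Uu3 : U \o u3 =1 u2).
Hypotheses (Ue1 : U \o e1 =1 e1) (Ue2 : U \o e2 =1 e2).
Hypotheses (Ux0 : U \o x0 =1 x0) (Ux1 : U \o x1 =1 x1) (Ux3 : U \o x3 =1 x3).

Hypothesis relT : bilinear_relation (shift d1) (shift d2) u1 u2 D12 e1 x1 (T \o x1) x0 x2.
Hypothesis relU : bilinear_relation (shift (shift d2)) (shift (shift d3)) u2 u3 D23 e2
  x2 (U \o x2) x1 x3.

Let mapN (f : {rmorphism K -> K}) (a b : 'Z_n -> K) : f \o a =1 b -> f (N a) = N b.
Proof. by move=> eab; rewrite rmorph_prod; apply: eq_bigr => h _; apply: eab. Qed.

Let map_shift (f : {rmorphism K -> K}) (a b : 'Z_n -> K) :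
  f \o a =1 b -> f \o shift a =1 shift b.
Proof. by move=> eab h; apply: eab. Qed.

Let TD23 : T D23 = D13.
Proof.
by rewrite rmorphB !rmorphM (mapN Td3) (mapN Tu2) (mapN Td2) (mapN Tu3).
Qed.

Let UD12 : U D12 = D13.
Proof.
by rewrite rmorphB !rmorphM (mapN Ud2) (mapN Uu1) (mapN Ud1) (mapN Uu2).
Qed.

Let TD13 : T D13 = D23.
Proof.
by rewrite rmorphB !rmorphM (mapN Td3) (mapN Tu1) (mapN Td1) (mapN Tu3).
Qed.

Let UD13 : U D13 = D12.
Proof.
by rewrite rmorphB !rmorphM (mapN Ud3) (mapN Uu1) (mapN Ud1) (mapN Uu3).
Qed.

Let D13_neq0 : D13 != 0. Proof. by rewrite -UD12 fmorph_eq0. Qed.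
Let D23_neq0 : D23 != 0. Proof. by rewrite -TD13 fmorph_eq0. Qed.

Let relUT : bilinear_relation (shift d1) (shift d3) u1 u3 D13 e1
  x1 (U \o (T \o x1)) x0 (U \o x2).
Proof. by apply: (relation_map (f := U) relT) => //; apply: map_shift. Qed.

Let relTU : bilinear_relation (shift (shift d1)) (shift (shift d3)) u1 u3 D13 e2
  x2 (T \o (U \o x2)) (T \o x1) x3.
Proof. by apply: (relation_map (f := T) relU) => //; do 2!apply: map_shift. Qed.

Let relTUT : bilinear_relation (shift d2) (shift d3) u2 u3 D23 e1
  (T \o x1) (T \o (U \o (T \o x1))) x0 (T \o (U \o x2)).
Proof. by apply: (relation_map (f := T) relUT) => //; apply: map_shift. Qed.

Let relUTU : bilinear_relation (shift (shift d1)) (shift (shift d2)) u1 u2 D12 e2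
  (U \o x2) (U \o (T \o (U \o x2))) (U \o (T \o x1)) x3.
Proof. by apply: (relation_map (f := U) relTU) => //; do 2!apply: map_shift. Qed.

Let rmorph_neq0 (f : {rmorphism K -> K}) a :
  (forall i, a i != 0) -> forall i : 'Z_n, (f \o a) i != 0.
Proof. by move=> an0 i; rewrite /= fmorph_eq0. Qed.

(** Starting from the rows x1 = t_1 and x2 = t_12, T U T yields t_2, t_23, t_3
    and U T U yields t_13, t_3, t_23.  The relations along the first path imply
    those along the second one, so the two values of t_3 and of t_23 agree by
    uniqueness. *)
Lemma braid_images :
  T \o (U \o (T \o x1)) =1 U \o (T \o (U \o x1))
  /\ T \o (U \o (T \o x2)) =1 U \o (T \o (U \o x2)).
Proof.
have neq12 : N d2 * N u1 != N d1 * N u2 by rewrite -subr_eq0.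
have neq13 : N d3 * N u1 != N d1 * N u3 by rewrite -subr_eq0.
have neq23 : N d3 * N u2 != N d2 * N u3 by rewrite -subr_eq0.
have bottom := braid_bottom n_gt1 e1_neq0 x0_neq0 (rmorph_neq0 T x1_neq0) x2_neq0
  D13_neq0 neq23 relT relTUT relTU relU.
have e3 : T \o (U \o (T \o x1)) =1 U \o (T \o x1).
  by apply: (relation_unique n_gt1 _ x1_neq0 bottom relUT); rewrite !prod_succ.
have top := braid_top n_gt1 e1_neq0 x0_neq0 (rmorph_neq0 T x1_neq0) x2_neq0
  D13_neq0 neq23 relT relTUT relTU relU.
have top' : bilinear_relation (shift (shift d1)) (shift (shift d2)) u1 u2 D12 e2
  (U \o x2) (T \o (U \o x2)) (U \o (T \o x1)) x3.
  by move=> i; rewrite -e3; apply: top.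
have e23 := relation_unique n_gt1 _ (rmorph_neq0 U x2_neq0) top' relUTU.
split=> i; first by rewrite e3 /=; congr (U (T _)); rewrite -[LHS]Ux1.
by rewrite -e23 ?prod_succ //=; congr (T (U _)); apply: Tx2.
Qed.

End BraidRelation.

(** * The frozen variables and the R-matrix in terms of strips *)

Section ClusterHom.
Local Open Scope ring_scope.

Variables (m n : nat) (n_gt1 : (1 < n)%N).
Notation F := (ratfun m n).
Notation poly := {mpoly rat[#|var m n|]}.
Implicit Types (i : 'Z_n) (j k : nat).

Notation x k i := (xvar m k i).

Definition hor k i : F := Xvar (vtx m k i) (vtx m k (i + 1)).
Definition down k i : F := Xvar (vtx m k i) (vtx m k.-1 i).
Definition up k i : F := Xvar (vtx m k.-1 i) (vtx m k (i - 1)).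

Lemma vtx_level k i : (k <= m)%N -> (vtx m k i).1 = k :> nat.
Proof. by move=> lekm; rewrite /= inordK. Qed.

Lemma pred_level k : (k <= m)%N -> (k.-1 <= m)%N.
Proof. exact: leq_trans (leq_pred k). Qed.

Lemma vtx_eta (a : vertex m n) : a = vtx m a.1 a.2.
Proof. by case: a => k i; rewrite /vtx /= inord_val. Qed.

(** The three disjuncts of the arrow relation are the three families of
    arrows; P is on field elements so that a variable can be met under its
    name hor, down or up. *)
Lemma gen_ind (P : F -> Prop) :
    (forall k i, (k <= m)%N -> P (x k i)) ->
    (forall k i, (k <= m)%N -> P (hor k i)) ->
    (forall k i, (0 < k <= m)%N -> P (down k i)) ->
    (forall k i, (0 < k <= m)%N -> P (up k i)) ->
  forall v, P (gen v).
Proof.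
move=> Px Ph Pd Pu [a | e].
  by rewrite [a]vtx_eta; apply: Px; rewrite -ltnS.
rewrite -X_arrow; case: e => -[a b] /= ab.
have := ab; rewrite [a]vtx_eta [b]vtx_eta.
have := ltn_ord a.1; have := ltn_ord b.1; rewrite !ltnS.
move: (nat_of_ord a.1) (nat_of_ord b.1) a.2 b.2 => k l i i' ltl ltk.
have vtx_site k' i'' : (vtx m k' i'').2 = i'' by [].
case/or3P; rewrite !vtx_level // !vtx_site => /andP[/eqP el /eqP ->].
- by rewrite el; apply: Ph.
- by rewrite -el in ltk *; apply: (Pd l.+1).
by rewrite el in ltl *; apply: (Pu k.+1).
Qed.

Lemma hor_arrow k i : (k <= m)%N -> arrow (vtx m k i) (vtx m k (i + 1)).
Proof. by move=> lekm; rewrite /arrow !vtx_level // !eqxx. Qed.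

Lemma down_arrow k i : (0 < k <= m)%N -> arrow (vtx m k i) (vtx m k.-1 i).
Proof.
case/andP=> k_gt0 lekm.
by rewrite /arrow !vtx_level ?pred_level // prednK // !eqxx !orbT.
Qed.

Lemma up_arrow k i : (0 < k <= m)%N -> arrow (vtx m k.-1 i) (vtx m k (i - 1)).
Proof.
case/andP=> k_gt0 lekm.
by rewrite /arrow !vtx_level ?pred_level // prednK // !eqxx !orbT.
Qed.

Lemma gen_inj : injective (@gen m n).
Proof.
move=> v w /eqP; rewrite /gen tofrac_eq => /eqP.
move/(congr1 (meval (fun t => (t == enum_rank v)%:R : rat))).
rewrite !mevalXU eqxx; case: eqP => [/enum_rank_inj // | _ /eqP].
by rewrite oner_eq0.
Qed.

Lemma gen_neq0 v : gen v != 0 :> F.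
Proof.
rewrite tofrac_eq0; apply/eqP => /(congr1 (meval (fun=> 1 : rat)))/eqP.
by rewrite mevalXU meval0 oner_eq0.
Qed.

Lemma x_neq0 k i : x k i != 0. Proof. exact: gen_neq0. Qed.

Lemma hor_neq0 k i : (k <= m)%N -> hor k i != 0.
Proof.
by move=> lekm; rewrite /hor /Xvar insubT ?hor_arrow // => H; apply: gen_neq0.
Qed.

Section Values.
Variables (j : nat) (f : F -> F).
Hypotheses (j_gt0 : (0 < j)%N) (ltjm : (j < m)%N).
Hypothesis fE : forall v, f (gen v) = Rvar j v.

Lemma value_hor k i : (k <= m)%N -> f (hor k i) = hor k i.
Proof.
by move=> lekm; apply: (value_X_other (j := j)); rewrite ?hor_arrow ?eqxx.
Qed.

Lemma value_down k i : (0 < k <= m)%N ->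
  f (down k i) = if k == j.+1 then down j (i + 1)
                 else if k == j then down j.+1 (i - 1) else down k i.
Proof.
move=> k_bd; have /andP[k_gt0 lekm] := k_bd.
have [->|nk1] := eqVneq k j.+1; first exact: value_X_down_above.
have [->|nk] := eqVneq k j.
  by rewrite /down -{1 2}(subrK 1 i) (value_X_down_below j_gt0).
apply: (value_X_other (j := j)); rewrite ?down_arrow // !vtx_level ?pred_level //.
by rewrite nk -eqSS prednK // nk1 orbT.
Qed.

Lemma value_up k i : (0 < k <= m)%N ->
  f (up k i) = if k == j.+1 then up j i
               else if k == j then up j.+1 i else up k i.
Proof.
move=> k_bd; have /andP[k_gt0 lekm] := k_bd.
have [->|nk1] := eqVneq k j.+1; first exact: value_X_up_above.
have [->|nk] := eqVneq k j; first exact: value_X_up_below.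
apply: (value_X_other (j := j)); rewrite ?up_arrow // !vtx_level ?pred_level //.
by rewrite nk -eqSS prednK // nk1 orbT.
Qed.

End Values.

Definition Afac j i := down j.+1 i * up j (i + 1).
Definition Bfac j i := down j i * up j.+1 i.

(** Shifting l and h by the representative of i turns the integer ranges
    of the definition into those of cyclic_sum. *)
Lemma RxE j i : Rx m j i
  = Rform (xvar m j.-1) (xvar m j) (xvar m j.+1) (hor j) (Afac j) (Bfac j) i.
Proof.
rewrite /Rx /Rform /cyclic_sum -{1 2 3}[i : nat]add0n big_addn addKn.
rewrite !big_distrr /=; apply: eq_bigr => s _.
have eF k : (k + i)%:R = i + k%:R :> 'Z_n by rewrite natrD natr_Zp addrC.
have eA : \prod_((s + i).+1 <= h < i + n)
    (Xvar (vtx m j.+1 h%:R) (vtx m j h%:R)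
     * Xvar (vtx m j.-1 h.+1%:R) (vtx m j h%:R))
    = \prod_(s.+1 <= h < n) Afac j (i + h%:R).
  rewrite -addSn big_addn addKn; apply: eq_bigr => h _.
  by rewrite -natr1 eF /Afac /down /up addrK.
have eB : \prod_(i.+1 <= h < (s + i).+1)
    (Xvar (vtx m j h%:R) (vtx m j.-1 h%:R)
     * Xvar (vtx m j h%:R) (vtx m j.+1 (h%:R - 1)))
    = \prod_(1 <= h < s.+1) Bfac j (i + h%:R).
  rewrite -add1n big_addn -addSn addnK; apply: eq_bigr => h _.
  by rewrite eF.
rewrite eA eB -natr1 eF -/(hor _ _) !mulrA; congr (_ * _ * _).
have := Rform_term (xvar m j.-1) (xvar m j.+1) (hor j) i (i + s%:R) (x_neq0 j).
by rewrite !mulrA => ->.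
Qed.

End ClusterHom.

(** * Nonvanishing by evaluation at rational points *)

Section Nonvanishing.
Local Open Scope ring_scope.

Variables (m n : nat) (n_gt1 : (1 < n)%N) (j : nat).
Hypothesis j_bd : (0 < j < m)%N.
Notation F := (ratfun m n).
Notation poly := {mpoly rat[#|var m n|]}.

Section Point.
Variable c : rat.

(** The variables down j.+1 take the value c and all others the value 1.  With
    c = 1 the terms of the R-matrix cannot cancel; with c = 2 the two products
    of frozen variables are told apart. *)
Definition point (v : var m n) : rat :=
  if v is inr e then
    if ((val e).1.1 == j.+1 :> nat) && ((val e).2.1 == j :> nat) then c else 1
  else 1.

Definition at_point : {rmorphism poly -> rat} := meval (fun t => point (enum_val t)).

Lemma gen_at_point v : specializes at_point (gen v) (point v).
Proof.
by have := specializes_tofrac at_point 'X_(enum_rank v); rewrite /= mevalXU enum_rankK.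
Qed.

Lemma Xvar_at_point (a b : vertex m n) : arrow a b ->
  specializes at_point (Xvar a b)
    (if (a.1 == j.+1 :> nat) && (b.1 == j :> nat) then c else 1).
Proof. by move=> ab; rewrite /Xvar insubT; apply: gen_at_point. Qed.

Lemma x_at_point k i : specializes at_point (xvar m k i) 1.
Proof. exact: gen_at_point. Qed.

Lemma hor_at_point k i : (k <= m)%N -> specializes at_point (hor m k i) 1.
Proof.
move=> lekm; have := Xvar_at_point (hor_arrow i lekm); rewrite !vtx_level //.
by case: eqVneq => //= ->; rewrite gtn_eqF.
Qed.

Lemma down_at_point k i : (0 < k <= m)%N ->
  specializes at_point (down m k i) (if k == j.+1 then c else 1).
Proof.
move=> k_bd; have /andP[k_gt0 lekm] := k_bd.
have := Xvar_at_point (down_arrow i k_bd); rewrite !vtx_level ?pred_level //.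
by case: eqVneq => //= ->; rewrite eqxx.
Qed.

Lemma up_at_point k i : (0 < k <= m)%N -> specializes at_point (up m k i) 1.
Proof.
move=> k_bd; have /andP[k_gt0 lekm] := k_bd.
have := Xvar_at_point (up_arrow i k_bd); rewrite !vtx_level ?pred_level //.
case: eqVneq => //= ek; rewrite gtn_eqF //.
by rewrite -(prednK k_gt0) ek ltnS ltnW.
Qed.

Lemma Afac_at_point i : specializes at_point (Afac m j i) c.
Proof.
have /andP[j_gt0 ltjm] := j_bd.
rewrite -[c]mulr1; apply: specializesM; last by apply: up_at_point; rewrite j_gt0 ltnW.
by have := down_at_point i (ltjm : 0 < j.+1 <= m)%N; rewrite eqxx.
Qed.

Lemma Bfac_at_point i : specializes at_point (Bfac m j i) 1.
Proof.
have /andP[j_gt0 ltjm] := j_bd.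
rewrite -[1]mulr1; apply: specializesM; last exact: up_at_point.
have /down_at_point : (0 < j <= m)%N by rewrite j_gt0 ltnW.
by rewrite ltn_eqF.
Qed.

End Point.

Lemma prod_Afac_neq_Bfac : \prod_h Afac m j h != \prod_(h : 'Z_n) Bfac m j h :> F.
Proof.
rewrite -subr_eq0; apply: (@specializes_neq0 _ _ (at_point 2) _ (2 ^+ #|'Z_n| - 1)).
  apply: specializesB.
    rewrite -prodr_const; apply: specializes_prod => h _; exact: Afac_at_point.
  rewrite -[X in specializes _ _ X](expr1n _ #|'Z_n|) -prodr_const.
  by apply: specializes_prod => h _; exact: Bfac_at_point.
by rewrite subr_eq0 card_ord gt_eqF ?exprn_egt1.
Qed.

(** At the point where all variables are 1, the sum counts its n terms. *)
Lemma Rx_neq0 i : Rx m j i != 0 :> F.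
Proof.
have /andP[j_gt0 ltjm] := j_bd.
rewrite RxE //; apply: (@specializes_neq0 _ _ (at_point 1) _
  (Rform (fun=> 1) (fun=> 1) (fun=> 1) (fun=> 1) (fun=> 1) (fun=> 1) i)).
  apply: specializes_Rform => h; [exact: oner_neq0 | exact: x_at_point.. | | |].
  - by apply: hor_at_point; apply: ltnW.
  - exact: Afac_at_point.
  - exact: Bfac_at_point.
rewrite /Rform /cyclic_sum mul1r.
under eq_bigr => s _ do rewrite /= !big1 // !mulr1.
by rewrite sumr_const_nat subn0 pnatr_eq0 -lt0n ltnW.
Qed.

End Nonvanishing.

(** * Algebraic independence of the images of the variables *)

Section FieldHom.
Local Open Scope ring_scope.

Variables (m n : nat) (n_gt1 : (1 < n)%N) (j : nat).
Hypothesis j_bd : (0 < j < m)%N.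
Notation F := (ratfun m n).
Notation poly := {mpoly rat[#|var m n|]}.

(** An arbitrary function with the prescribed values on the variables is enough
    to express the table of values below before the R-matrix is known to be a
    homomorphism. *)
Lemma function_on_gens (y : var m n -> F) :
  {f : F -> F | forall v, f (gen v) = y v}.
Proof.
exists (fun g => if [pick v | gen v == g] is Some v then y v else 0) => v.
case: pickP => [w /eqP/gen_inj -> // | /(_ v)].
by rewrite eqxx.
Qed.

Let j_gt0 : (0 < j)%N. Proof. by case/andP: j_bd. Qed.
Let ltjm : (j < m)%N. Proof. by case/andP: j_bd. Qed.

Section Values.
Variable f : F -> F.
Hypothesis fE : forall v, f (gen v) = Rvar j v.

Lemma value_Afac i : f (down m j.+1 i) * f (up m j (i + 1)) = Bfac m j (i + 1).
Proof.
rewrite (value_down j_gt0 ltjm fE) // (value_up j_gt0 ltjm fE) ?j_gt0 1?ltnW //.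
by rewrite !eqxx ltn_eqF.
Qed.

Lemma value_Bfac i : f (down m j i) * f (up m j.+1 i) = Afac m j (i - 1).
Proof.
rewrite (value_down j_gt0 ltjm fE) ?j_gt0 1?ltnW // (value_up j_gt0 ltjm fE) //.
by rewrite !eqxx ltn_eqF // /Afac subrK.
Qed.

(** The R-matrix is an involution, stated as an evaluation of its defining
    expression at the images of the variables. *)
Lemma Rform_value_x i :
  Rform (fun i => f (xvar m j.-1 i)) (fun i => f (xvar m j i))
    (fun i => f (xvar m j.+1 i)) (fun i => f (hor m j i))
    (fun i => f (down m j.+1 i) * f (up m j (i + 1)))
    (fun i => f (down m j i) * f (up m j.+1 i)) i = xvar m j i.
Proof.
have RE : @Rx m n j =1 Rform _ _ _ _ _ _ := RxE m j.
have Rn0 (k : 'Z_n) : Rform (xvar m j.-1) (xvar m j) (xvar m j.+1) (hor m j)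
    (Afac m j) (Bfac m j) k != 0 by rewrite -RE; apply: Rx_neq0.
rewrite -[RHS](Rform_involutive n_gt1 (prod_Afac_neq_Bfac n j_bd) _ Rn0);
  last by move=> k; apply: x_neq0.
apply: eq_Rform => k.
- by rewrite (value_x_other fE) ?pred_level 1?ltnW // ltn_eqF // prednK.
- by rewrite (value_x ltjm fE) RE.
- by rewrite (value_x_other fE) // gtn_eqF.
- by rewrite (value_hor fE) // ltnW.
- exact: value_Afac.
exact: value_Bfac.
Qed.

End Values.

(** Evaluation at the images Rvar j is partially defined on fractions, and it
    sends each image Rvar j v back to the variable v.  Hence it sends p(Rvar j)
    to p; if p(Rvar j) = 0, then p = 0. *)
Lemma Rvar_independent (p : poly) : evalp (Rvar j) p = 0 -> p = 0.
Proof.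
have [f fE] := function_on_gens (@Rvar m n j).
have [phi phiE] := evalp_hom (@Rvar m n j).
have phi_gen v : specializes phi (gen v) (f (gen v)).
  by rewrite fE -[Rvar j v]evalp_gen -phiE; apply: specializes_tofrac.
have specX (a b : vertex m n) : arrow a b -> specializes phi (Xvar a b) (f (Xvar a b)).
  by move=> ab; rewrite /Xvar insubT; apply: phi_gen.
have spec_down k i : (0 < k <= m)%N -> specializes phi (down m k i) (f (down m k i)).
  by move=> /(down_arrow i)/specX.
have spec_up k i : (0 < k <= m)%N -> specializes phi (up m k i) (f (up m k i)).
  by move=> /(up_arrow i)/specX.
have j_le : (0 < j <= m)%N by rewrite j_gt0 ltnW.
have spec_inv g : (exists v, g = gen v) -> specializes phi (f g) g.
  case=> v ->; move: v.
  apply: (gen_ind (P := fun g => specializes phi (f g) g)) => k i k_bd.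
  - have [->|nkj] := eqVneq k j; last first.
      by have := phi_gen (inl (vtx m k i)); rewrite (value_x_other fE i k_bd nkj).
    rewrite (value_x ltjm fE) RxE -[X in specializes _ _ X](Rform_value_x fE).
    apply: specializes_Rform => h; try exact: phi_gen.
    + by rewrite (value_x ltjm fE) Rx_neq0.
    + by apply: specX; apply: hor_arrow; apply: ltnW.
    + by apply: specializesM; [apply: spec_down | apply: spec_up].
    + by apply: specializesM; [apply: spec_down | apply: spec_up].
  - by have := specX _ _ (hor_arrow i k_bd); rewrite (value_hor fE i k_bd).
  - rewrite (value_down j_gt0 ltjm fE) //.
    have [->|nk1] := eqVneq k j.+1.
      have := spec_down j (i + 1) j_le.
      by rewrite (value_down j_gt0 ltjm fE) // ltn_eqF // eqxx addrK.
    have [->|nk] := eqVneq k j.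
      have := spec_down j.+1 (i - 1) ltjm.
      by rewrite (value_down j_gt0 ltjm fE) // eqxx subrK.
    have := spec_down k i k_bd.
    by rewrite (value_down j_gt0 ltjm fE) // (negPf nk1) (negPf nk).
  rewrite (value_up j_gt0 ltjm fE) //.
  have [->|nk1] := eqVneq k j.+1.
    have := spec_up j i j_le.
    by rewrite (value_up j_gt0 ltjm fE) // ltn_eqF // eqxx.
  have [->|nk] := eqVneq k j.
    have := spec_up j.+1 i ltjm.
    by rewrite (value_up j_gt0 ltjm fE) // eqxx.
  have := spec_up k i k_bd.
  by rewrite (value_up j_gt0 ltjm fE) // (negPf nk1) (negPf nk).
have spec_eval q : specializes phi (evalp (Rvar j) q) (tofrac q).
  elim/mpolyind: q => [|c mm q _ _ IH].
    by rewrite -phiE !rmorph0; apply: specializes0.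
  rewrite -phiE !rmorphD; apply: specializesD; last by rewrite phiE.
  rewrite -mul_mpolyC !rmorphM; apply: specializesM.
    have := specializes_tofrac phi (c%:MP); rewrite !phiE /evalp mmapC.
    by [].
  rewrite mpolyXE_id !rmorph_prod; apply: specializes_prod => t _.
  rewrite !rmorphXn; elim: (mm t) => [|e IHe]; first exact: specializes1.
  rewrite !exprS; apply: specializesM IHe.
  rewrite phiE -[t]enum_valK evalp_gen -fE.
  by apply: spec_inv; exists (enum_val t).
move=> p0; apply/eqP; rewrite -tofrac_eq0; apply/eqP.
have := spec_eval p; rewrite p0 => spec0.
exact: specializes_unique spec0 (specializes0 phi).
Qed.

Lemma clusterR_hom : field_hom (@clusterR m n j) /\
  forall v, clusterR j (gen v) = Rvar j v :> F.
Proof. exact: subst_field_hom Rvar_independent. Qed.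

End FieldHom.

(** * Relations between the cluster R-matrices *)

Section Relations.
Local Open Scope ring_scope.

Variables (m n : nat) (n_gt1 : (1 < n)%N).
Notation F := (ratfun m n).
Implicit Types (j k l : nat) (T U : {rmorphism F -> F}).

Lemma rmorphism_field_hom (f : {rmorphism F -> F}) : field_hom f.
Proof. by split; [apply: rmorphB | split; [apply: rmorph1 | apply: rmorphM]]. Qed.

Lemma field_hom_comp (f g : F -> F) : field_hom f -> field_hom g -> field_hom (f \o g).
Proof.
move=> [fB [f1 fM]] [gB [g1 gM]]; split; first by move=> a b; rewrite /= gB fB.
by split; [rewrite /= g1 | move=> a b; rewrite /= gM fM].
Qed.

Lemma field_hom_id : field_hom (@id F).
Proof. exact: (rmorphism_field_hom idfun). Qed.

Lemma clusterR_rmorphism j : (0 < j < m)%N ->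
  {T : {rmorphism F -> F} | T =1 @clusterR m n j & forall v, T (gen v) = Rvar j v}.
Proof.
move=> j_bd; have [hom RE] := clusterR_hom n_gt1 j_bd.
have [T TE] := rmorphism_of_field_hom hom.
by exists T => // v; rewrite TE RE.
Qed.

(** All that the proof of the braid relation uses of the formula for the
    R-matrix. *)
Lemma clusterR_relation j T : (0 < j < m)%N -> (forall v, T (gen v) = Rvar j v) ->
  bilinear_relation (fun i => down m j (i + 1)) (down m j.+1) (up m j) (up m j.+1)
    (\prod_h down m j.+1 h * \prod_h up m j h
     - \prod_h down m j h * \prod_h up m j.+1 h)
    (hor m j) (xvar m j) (T \o xvar m j) (xvar m j.-1) (@xvar m n j.+1).
Proof.
case/andP=> j_gt0 ltjm TE i.
have := Rform_bilinear n_gt1 (xvar m j.-1) (xvar m j.+1) (hor m j)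
  (Afac m j) (Bfac m j) i (@x_neq0 m n j).
by rewrite -!RxE -!(value_x ltjm TE) !big_split /= prod_succ.
Qed.

Lemma clusterR_rmorphism_involutive j T :
  (0 < j < m)%N -> (forall v, T (gen v) = Rvar j v) -> T \o T =1 id.
Proof.
move=> j_bd TE; have /andP[j_gt0 ltjm] := j_bd.
have j_le : (0 < j <= m)%N by rewrite j_gt0 ltnW.
apply: (field_hom_ext (rmorphism_field_hom (T \o T)) field_hom_id).
apply: (gen_ind (P := fun z => T (T z) = z)) => k i k_bd /=.
- have [->|nkj] := eqVneq k j; last by rewrite !(value_x_other TE).
  rewrite (value_x ltjm TE) RxE map_Rform -[RHS](Rform_value_x n_gt1 j_bd TE).
  by apply: eq_Rform => h //=; rewrite rmorphM.
- by rewrite !(value_hor TE).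
- rewrite [T (down _ _ _)](value_down j_gt0 ltjm TE) //.
  have [->|nk1] := eqVneq k j.+1.
    by rewrite (value_down j_gt0 ltjm TE) // ltn_eqF // eqxx addrK.
  have [->|nk] := eqVneq k j.
    by rewrite (value_down j_gt0 ltjm TE) // eqxx subrK.
  by rewrite (value_down j_gt0 ltjm TE) // (negPf nk1) (negPf nk).
rewrite [T (up _ _ _)](value_up j_gt0 ltjm TE) //.
have [->|nk1] := eqVneq k j.+1.
  by rewrite (value_up j_gt0 ltjm TE) // ltn_eqF // eqxx.
have [->|nk] := eqVneq k j.
  by rewrite (value_up j_gt0 ltjm TE) // eqxx.
by rewrite (value_up j_gt0 ltjm TE) // (negPf nk1) (negPf nk).
Qed.

Section Commutation.
Variables (j k : nat) (T U : {rmorphism F -> F}).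
Hypotheses (j_bd : (0 < j < m)%N) (k_bd : (0 < k < m)%N).
Hypothesis far : (j.+1 < k)%N || (k.+1 < j)%N.
Hypothesis TE : forall v, T (gen v) = Rvar j v.
Hypothesis UE : forall v, U (gen v) = Rvar k v.

Let j_gt0 : (0 < j)%N. Proof. by case/andP: j_bd. Qed.
Let ltjm : (j < m)%N. Proof. by case/andP: j_bd. Qed.
Let k_gt0 : (0 < k)%N. Proof. by case/andP: k_bd. Qed.
Let ltkm : (k < m)%N. Proof. by case/andP: k_bd. Qed.

Let fix_down l i : (0 < l <= m)%N -> l != k -> l != k.+1 ->
  U (down m l i) = down m l i.
Proof.
by move=> ? /negPf nk /negPf nk1; rewrite (value_down k_gt0 ltkm UE) // nk nk1.
Qed.

Let fix_up l i : (0 < l <= m)%N -> l != k -> l != k.+1 -> U (up m l i) = up m l i.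
Proof.
by move=> ? /negPf nk /negPf nk1; rewrite (value_up k_gt0 ltkm UE) // nk nk1.
Qed.

Let far_neq : [/\ j != k, j != k.+1, j.+1 != k, j.+1 != k.+1 & j.-1 != k].
Proof. by move: far j_gt0; clear; case: j => // j'; split; lia. Qed.

(** U fixes every variable in the formula for T (x l), provided that the levels
    are not adjacent.  The case l = k follows by exchanging T and U. *)
Lemma commute_x l i : (l <= m)%N -> l != k -> T (U (xvar m l i)) = U (T (xvar m l i)).
Proof.
move=> lelm nlk; rewrite (value_x_other UE) //.
have [->|nlj] := eqVneq l j; last by rewrite !(value_x_other TE) // (value_x_other UE).
have [nk nk1 nSk _ npk] := far_neq.
rewrite (value_x ltjm TE) RxE map_Rform; apply: eq_Rform => h /=.
- by rewrite (value_x_other UE) // pred_level // ltnW.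
- by rewrite (value_x_other UE) // ltnW.
- by rewrite (value_x_other UE).
- by rewrite (value_hor UE) // ltnW.
- by rewrite rmorphM fix_down ?fix_up ?j_gt0 //= ltnW.
by rewrite rmorphM fix_down ?fix_up ?j_gt0 //= ltnW.
Qed.

Lemma commute_down l i : (0 < l <= m)%N -> l != k -> l != k.+1 ->
  T (U (down m l i)) = U (T (down m l i)).
Proof.
move=> l_bd nlk nlk1; rewrite fix_down // (value_down j_gt0 ltjm TE) //.
have [nk nk1 nSk _ npk] := far_neq.
case: eqP => _; first by rewrite fix_down // j_gt0 ltnW.
by case: eqP => _; rewrite fix_down.
Qed.

Lemma commute_up l i : (0 < l <= m)%N -> l != k -> l != k.+1 ->
  T (U (up m l i)) = U (T (up m l i)).
Proof.
move=> l_bd nlk nlk1; rewrite fix_up // (value_up j_gt0 ltjm TE) //.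
have [nk nk1 nSk _ npk] := far_neq.
case: eqP => _; first by rewrite fix_up // j_gt0 ltnW.
by case: eqP => _; rewrite fix_up.
Qed.

End Commutation.

Lemma clusterR_rmorphism_commute j k T U :
    (0 < j < m)%N -> (0 < k < m)%N -> (j.+1 < k)%N || (k.+1 < j)%N ->
    (forall v, T (gen v) = Rvar j v) -> (forall v, U (gen v) = Rvar k v) ->
  T \o U =1 U \o T.
Proof.
move=> j_bd k_bd far TE UE.
have far' : (k.+1 < j)%N || (j.+1 < k)%N by rewrite orbC.
apply: (field_hom_ext (rmorphism_field_hom (T \o U)) (rmorphism_field_hom (U \o T))).
apply: (gen_ind (P := fun z => T (U z) = U (T z))) => l i l_bd.
- have [->|nlk] := eqVneq l k; last exact: (commute_x j_bd _ _ TE UE).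
  by apply/esym/(commute_x k_bd j_bd far' UE TE); lia.
- by rewrite !(value_hor UE) // !(value_hor TE) // (value_hor UE).
- case: (boolP ((l != k) && (l != k.+1))) => [/andP[nk nk1] |].
    exact: (commute_down j_bd k_bd far TE UE).
  by move=> lk; apply/esym/(commute_down k_bd j_bd far' UE TE) => //; lia.
case: (boolP ((l != k) && (l != k.+1))) => [/andP[nk nk1] |].
    exact: (commute_up j_bd k_bd far TE UE).
by move=> lk; apply/esym/(commute_up k_bd j_bd far' UE TE) => //; lia.
Qed.

(** On the rows j and j + 1 this is the abstract braid relation; on frozen
    variables it is the braid relation of the transpositions of three strips. *)
Lemma clusterR_rmorphism_braid j T U : (0 < j)%N -> (j.+1 < m)%N ->
    (forall v, T (gen v) = Rvar j v) -> (forall v, U (gen v) = Rvar j.+1 v) ->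
  T \o (U \o T) =1 U \o (T \o U).
Proof.
move=> j_gt0 ltj1m TE UE; have ltjm := ltnW ltj1m.
have j_bd : (0 < j < m)%N by rewrite j_gt0.
have j1_bd : (0 < j.+1 < m)%N by [].
have relT := clusterR_relation j_bd TE; have relU := clusterR_relation j1_bd UE.
pose d1 := @down m n j.
(* The shifts undo those that T and U make when they exchange strips. *)
pose d2 i := @down m n j.+1 (i - 1).
pose d3 i := @down m n j.+2 (i - 1 - 1).
have vTd k i := @value_down m n j T j_gt0 ltjm TE k i.
have vTu k i := @value_up m n j T j_gt0 ltjm TE k i.
have vUd k i := @value_down m n j.+1 U isT ltj1m UE k i.
have vUu k i := @value_up m n j.+1 U isT ltj1m UE k i.
have j_le : (0 < j <= m)%N by rewrite j_gt0 ltnW.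
have nj2 : (j == j.+2) = false by lia.
have nj1 : (j == j.+1) = false by lia.
have n1j : (j.+1 == j) = false by lia.
have n2j : (j.+2 == j) = false by lia.
have n21 : (j.+2 == j.+1) = false by lia.
have n12 : (j.+1 == j.+2) = false by lia.
have Td1 i : T (d1 i) = d2 i by rewrite vTd // nj1 eqxx.
have Td2 i : T (d2 i) = d1 i by rewrite vTd // eqxx subrK.
have Td3 i : T (d3 i) = d3 i by rewrite vTd // n21 n2j.
have Ud1 i : U (d1 i) = d1 i by rewrite vUd // nj2 nj1.
have Ud2 i : U (d2 i) = d3 i by rewrite vUd // n12 eqxx.
have Ud3 i : U (d3 i) = d2 i by rewrite vUd // eqxx subrK.
have Tu1 i : T (up m j i) = up m j.+1 i by rewrite vTu // nj1 eqxx.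
have Tu2 i : T (up m j.+1 i) = up m j i by rewrite vTu // eqxx.
have Tu3 i : T (up m j.+2 i) = up m j.+2 i by rewrite vTu // n21 n2j.
have Uu1 i : U (up m j i) = up m j i by rewrite vUu // nj2 nj1.
have Uu2 i : U (up m j.+1 i) = up m j.+2 i by rewrite vUu // n12 eqxx.
have Uu3 i : U (up m j.+2 i) = up m j.+1 i by rewrite vUu // eqxx.
have Nd2 : \prod_h d2 h = \prod_h down m j.+1 h by apply: prod_pred.
have Nd3 : \prod_h d3 h = \prod_h down m j.+2 h.
  by rewrite /d3 (prod_pred (fun h => down m j.+2 (h - 1))) prod_pred.
have Tx l : (l <= m)%N -> l != j -> T \o xvar m l =1 @xvar m n l.
  by move=> lelm nlj i; apply: (value_x_other TE).
have Ux l : (l <= m)%N -> l != j.+1 -> U \o xvar m l =1 @xvar m n l.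
  by move=> lelm nlj i; apply: (value_x_other UE).
have Th l : (l <= m)%N -> T \o hor m l =1 @hor m n l.
  by move=> lelm i; apply: (value_hor TE).
have Uh l : (l <= m)%N -> U \o hor m l =1 @hor m n l.
  by move=> lelm i; apply: (value_hor UE).
have hypT : bilinear_relation (fun i => d1 (i + 1)) (fun i => d2 (i + 1))
    (up m j) (up m j.+1)
    (\prod_h d2 h * \prod_h up m j h - \prod_h d1 h * \prod_h up m j.+1 h)
    (hor m j) (xvar m j) (T \o xvar m j) (xvar m j.-1) (@xvar m n j.+1).
  by rewrite Nd2 => i; rewrite /d2 addrK; apply: relT.
have hypU : bilinear_relation (fun i => d2 (i + 1 + 1)) (fun i => d3 (i + 1 + 1))
    (up m j.+1) (up m j.+2)
    (\prod_h d3 h * \prod_h up m j.+1 h - \prod_h d2 h * \prod_h up m j.+2 h)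
    (hor m j.+1) (xvar m j.+1) (U \o xvar m j.+1) (xvar m j) (@xvar m n j.+2).
  by rewrite Nd2 Nd3 => i; rewrite /d2 /d3 !addrK; apply: relU.
have D12_neq0 : \prod_h d2 h * \prod_h up m j h
    - \prod_h d1 h * \prod_h up m j.+1 h != 0.
  rewrite Nd2 subr_eq0 -[X in _ * X != _]prod_succ -!big_split /=.
  exact: prod_Afac_neq_Bfac j_bd.
have xn0 l i : xvar m l i != 0 := @x_neq0 m n l i.
have hn0 i : hor m j i != 0 := @hor_neq0 m n j i (ltnW ltjm).
have Te1 := Th j (ltnW ltjm); have Te2 := Th j.+1 ltjm.
have Ue1 := Uh j (ltnW ltjm); have Ue2 := Uh j.+1 ltjm.
have Tx0 : T \o xvar m j.-1 =1 @xvar m n j.-1 by apply: Tx; lia.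
have Tx2 : T \o xvar m j.+1 =1 @xvar m n j.+1 by apply: Tx; lia.
have Tx3 : T \o xvar m j.+2 =1 @xvar m n j.+2 by apply: Tx; lia.
have Ux0 : U \o xvar m j.-1 =1 @xvar m n j.-1 by apply: Ux; lia.
have Ux1 : U \o xvar m j =1 @xvar m n j by apply: Ux; lia.
have Ux3 : U \o xvar m j.+2 =1 @xvar m n j.+2 by apply: Ux; lia.
have [bx1 bx2] := braid_images n_gt1 hn0 D12_neq0 (xn0 _) (xn0 _) (xn0 _)
  Td1 Td2 Td3 Tu1 Tu2 Tu3 Te1 Te2 Tx0 Tx2 Tx3
  Ud1 Ud2 Ud3 Uu1 Uu2 Uu3 Ue1 Ue2 Ux0 Ux1 Ux3 hypT hypU.
apply: (field_hom_ext (rmorphism_field_hom (T \o (U \o T)))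
  (rmorphism_field_hom (U \o (T \o U)))).
apply: (gen_ind (P := fun z => T (U (T z)) = U (T (U z)))) => l i l_bd.
- have [->|nlj] := eqVneq l j; first exact: bx1.
  have [->|nlj1] := eqVneq l j.+1; first exact: bx2.
  by rewrite !(value_x_other UE, value_x_other TE).
- by rewrite !(value_hor TE, value_hor UE).
- have [->|nlj] := eqVneq l j.
    by rewrite -[down m j i]/(d1 i) !(Td1, Ud1, Td2, Ud2, Td3, Ud3).
  have [->|nlj1] := eqVneq l j.+1.
    have -> : down m j.+1 i = d2 (i + 1) by rewrite /d2 addrK.
    by rewrite !(Td1, Ud1, Td2, Ud2, Td3, Ud3).
  have [->|nlj2] := eqVneq l j.+2.
    have -> : down m j.+2 i = d3 (i + 1 + 1) by rewrite /d3 !addrK.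
    by rewrite !(Td1, Ud1, Td2, Ud2, Td3, Ud3).
  have Tl : T (down m l i) = down m l i by rewrite vTd // (negPf nlj) (negPf nlj1).
  have Ul : U (down m l i) = down m l i by rewrite vUd // (negPf nlj2) (negPf nlj1).
  by rewrite !(Tl, Ul).
have [->|nlj] := eqVneq l j; first by rewrite !(Tu1, Uu1, Tu2, Uu2, Tu3, Uu3).
have [->|nlj1] := eqVneq l j.+1; first by rewrite !(Tu1, Uu1, Tu2, Uu2, Tu3, Uu3).
have [->|nlj2] := eqVneq l j.+2; first by rewrite !(Tu1, Uu1, Tu2, Uu2, Tu3, Uu3).
have Tl : T (up m l i) = up m l i by rewrite vTu // (negPf nlj) (negPf nlj1).
have Ul : U (up m l i) = up m l i by rewrite vUu // (negPf nlj2) (negPf nlj1).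
by rewrite !(Tl, Ul).
Qed.

End Relations.

(** * The Coxeter presentation of the symmetric group *)

Section Coxeter.

(** The letter at the head of w acts first, in agreement with the product of
    permutations. *)
Definition act (T : Type) (f : nat -> T -> T) (w : seq nat) (x : T) : T :=
  foldl (fun y j => f j y) x w.

Lemma act_cat (T : Type) (f : nat -> T -> T) w u x :
  act f (w ++ u) x = act f u (act f w x).
Proof. exact: foldl_cat. Qed.

Variable m : nat.
Implicit Types (j k r x : nat) (w u : seq nat).

Record coxeter_relations (T : Type) (f : nat -> T -> T) : Prop := CoxeterRelations {
  cox_invol : forall j, 0 < j < m -> f j \o f j =1 id;
  cox_braid : forall j, 0 < j -> j.+1 < m ->
    f j \o f j.+1 \o f j =1 f j.+1 \o f j \o f j.+1;
  cox_comm : forall j k, 0 < j -> j.+1 < k -> k < m -> f j \o f k =1 f k \o f j }.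

(** Equality in the Coxeter group, described by all its actions instead of by
    derivations. *)
Definition word_equiv w u : Prop :=
  forall (T : Type) (f : nat -> T -> T), coxeter_relations f -> act f w =1 act f u.

Lemma word_equiv_refl w : word_equiv w w. Proof. by []. Qed.

Lemma word_equiv_sym w u : word_equiv w u -> word_equiv u w.
Proof. by move=> wu T f fR x; rewrite wu. Qed.

Lemma word_equiv_trans w u v : word_equiv w u -> word_equiv u v -> word_equiv w v.
Proof. by move=> wu uv T f fR x; rewrite wu // uv. Qed.

Lemma word_equiv_cat w w' u u' :
  word_equiv w w' -> word_equiv u u' -> word_equiv (w ++ u) (w' ++ u').
Proof. by move=> ww uu T f fR x; rewrite !act_cat ww // uu. Qed.

Definition letters r w := all (fun j => 0 < j <= r) w.

Lemma commute_letter j w : 0 < j < m ->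
    all (fun k => [&& 0 < k < m & (j.+1 < k) || (k.+1 < j)]) w ->
  word_equiv (w ++ [:: j]) (j :: w).
Proof.
move=> /andP[j0 jm]; elim: w => [|k w IH] //= /andP[/andP[/andP[k0 km] far] /IH wE].
move=> T f fR x; rewrite /= -[LHS]/(act f (w ++ [:: j]) (f k x)) wE //=.
congr (act f w _); case/orP: far => h.
  exact: (cox_comm fR j0 h km).
by symmetry; exact: (cox_comm fR k0 h jm).
Qed.

(** r, r-1, ..., r-d+1: these words represent the cosets of the subgroup
    generated by the letters below r. *)
Fixpoint descend r d : seq nat := if d is d'.+1 then r :: descend r.-1 d' else [::].

Lemma descend_cat r d e : descend r (d + e) = descend r d ++ descend (r - d) e.
Proof.
elim: d r => [|d IH] r; first by rewrite add0n subn0.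
by rewrite addSn /= IH; case: r => [|r] //=; rewrite sub0n.
Qed.

Lemma mem_descend r d k : d <= r -> k \in descend r d -> r - d < k <= r.
Proof.
elim: d r => [|d IH] r //= led; rewrite inE => /orP[/eqP -> |/IH]; lia.
Qed.

(** A letter j after the coset word r ... k+1, with k = r - d: it commutes to the
    front if j < k, extends the word if j = k, cancels its last letter if
    j = k + 1, and if j > k + 1 it meets j, j-1 inside the word, where the braid
    relation turns it into j - 1, which commutes to the front. *)
Lemma descend_step r d j : r < m -> d <= r -> 0 < j <= r ->
  exists w e, [/\ letters r.-1 w, e <= r
    & word_equiv (descend r d ++ [:: j]) (w ++ descend r e)].
Proof.
move=> ltrm led /andP[j0 jr].
have [ltj|] := ltnP j (r - d).
  exists [:: j], d; split=> //; first by rewrite /= j0; lia.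
  apply: commute_letter; first by lia.
  by apply/allP => k /(mem_descend led); lia.
rewrite leq_eqVlt => /predU1P[ej | ].
  exists [::], d.+1; split=> //; first by lia.
  by rewrite -ej -addn1 descend_cat; apply: word_equiv_refl.
rewrite leq_eqVlt => /predU1P[ej | ltj].
  case: d => [|d] in led ej *; first by lia.
  exists [::], d; split=> //; first by lia.
  rewrite -[d.+1]addn1 descend_cat -catA -[X in word_equiv _ X]cats0.
  apply: word_equiv_cat; first exact: word_equiv_refl.
  have -> : r - d = j by lia.
  by move=> T f fR x; apply: (cox_invol fR); lia.
exists [:: j.-1], d; split=> //; first by rewrite /=; lia.
have dE : d = (r - j) + (2 + (d - (r - j) - 2)) by lia.
set e := d - (r - j) - 2 in dE.
have -> : descend r d = descend r (r - j) ++ [:: j; j.-1] ++ descend j.-2 e.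
  rewrite {1}dE !descend_cat /=; have -> : r - (r - j) = j by lia.
  by have -> : j - 2 = j.-2 by lia.
have tailE : word_equiv (descend j.-2 e ++ [:: j]) (j :: descend j.-2 e).
  apply: commute_letter; first by lia.
  apply/allP => k /mem_descend; lia.
have headE : word_equiv (descend r (r - j) ++ [:: j.-1]) (j.-1 :: descend r (r - j)).
  apply: commute_letter; first by lia.
  apply/allP => k /mem_descend; lia.
move=> T f fR x; rewrite !act_cat /=.
have := headE T f fR x; rewrite act_cat /= => <-.
have := tailE T f fR; rewrite /= => tE.
rewrite -[LHS]/(act f [:: j] (act f (descend j.-2 e) _)) -act_cat tE /=.
congr (act f _ _).
have j1 : 0 < j.-1 by lia.
have j2 : j.-1.+1 < m by lia.
by have := cox_braid fR j1 j2 (act f (descend r (r - j)) x); rewrite /= prednK.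
Qed.

Lemma normal_form r w : r < m -> letters r w ->
  exists u d, [/\ letters r.-1 u, d <= r & word_equiv w (u ++ descend r d)].
Proof.
move=> ltrm; elim/last_ind: w => [|w j IH].
  by move=> _; exists [::], 0; split=> //; apply: word_equiv_refl.
rewrite /letters all_rcons => /andP[jr /IH[u [d [ur led wE]]]].
have [v [e [vr lee dE]]] := descend_step ltrm led jr.
exists (u ++ v), e; split=> //; first by rewrite /letters all_cat; apply/andP.
rewrite -cats1 -catA.
apply: (word_equiv_trans (u := (u ++ descend r d) ++ [:: j])).
  by apply: word_equiv_cat => //; apply: word_equiv_refl.
by rewrite -catA; apply: word_equiv_cat => //; apply: word_equiv_refl.
Qed.

(** The permutations of nat by adjacent transpositions form the action that
    separates normal forms. *)
Definition swap j x : nat := if x == j.-1 then j else if x == j then j.-1 else x.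

(* Splits the tests of nested swaps from the inside out, which leaves only
   linear arithmetic. *)
Ltac swap_cases := rewrite /swap /=; repeat match goal with
  | |- context [?a == ?b] => lazymatch a with
    | context [if _ then _ else _] => fail
    | _ => case: (a =P b) => ? /=
    end
  end.

Lemma swap_coxeter : coxeter_relations swap.
Proof.
by split=> [j jm x | j j0 jm x | j k j0 jk km x]; swap_cases; lia.
Qed.

Lemma swap_descend_last r d : d <= r -> act swap (descend r d) r = r - d.
Proof.
elim: d r => [|d IH] r led /=; first by rewrite subn0.
have -> : swap r r = r.-1 by swap_cases; lia.
by rewrite IH; lia.
Qed.

Lemma swap_letters_last r w x : letters r w -> r < x -> act swap w x = x.
Proof.
move=> /allP; elim: w => //= j w IH wr ltrx.
have -> : swap j x = x.
  have := wr j (mem_head _ _); swap_cases; lia.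
by apply: IH => // k kw; apply: wr; rewrite inE kw orbT.
Qed.

Lemma swap_inj r w : r < m -> letters r w -> injective (act swap w).
Proof.
move=> ltrm; rewrite /letters; elim: w => [_ x y //|j w IH] /= /andP[jr wr].
have swapK : involutive (swap j) by apply: (cox_invol swap_coxeter); lia.
exact: inj_comp (IH wr) (inv_inj swapK).
Qed.

(** In normal form the point r can be moved only by the coset word, which
    sends it to r - d; so the permutation determines d, and after cancelling
    the coset word the claim is that for r - 1. *)
Lemma swap_faithful r w u : r < m -> letters r w -> letters r u ->
  act swap w =1 act swap u -> word_equiv w u.
Proof.
elim: r w u => [|r IH] w u ltrm wr ur ewu.
  have nil v : letters 0 v -> v = [::] by case: v => //= j v; rewrite /letters /=; lia.
  by rewrite (nil w) // (nil u) //; apply: word_equiv_refl.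
have [w' [d [wr' led wE]]] := normal_form ltrm wr.
have [u' [e [ur' lee uE]]] := normal_form ltrm ur.
have ewu' x : act swap (descend r.+1 d) (act swap w' x)
            = act swap (descend r.+1 e) (act swap u' x).
  by rewrite -!act_cat -wE ?ewu ?uE //; apply: swap_coxeter.
have ede : d = e.
  have := ewu' r.+1; rewrite (swap_letters_last wr' (ltnSn r)).
  rewrite (swap_letters_last ur' (ltnSn r)).
  by rewrite !swap_descend_last //; lia.
rewrite -ede in uE ewu'.
have dl : letters r.+1 (descend r.+1 d).
  by apply/allP => k /(mem_descend led); lia.
apply: word_equiv_trans wE _; apply: word_equiv_sym.
apply: word_equiv_trans uE _; apply: word_equiv_sym.
apply: word_equiv_cat; last exact: word_equiv_refl.
apply: IH => //; first exact: ltnW.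
by move=> x; apply: (swap_inj ltrm dl); apply: ewu'.
Qed.

End Coxeter.

(** * Actions of the symmetric group from its generators *)

Section SymmetricAction.

Variables (m : nat) (T : Type) (f : nat -> T -> T).
Hypothesis fR : coxeter_relations m.+1 f.

Definition simple_perm j : {perm 'I_m.+1} := tperm (inord j.-1) (inord j).
Definition word_perm (w : seq nat) : {perm 'I_m.+1} := (\prod_(j <- w) simple_perm j)%g.

Lemma simple_permE j (i : 'I_m.+1) : 0 < j <= m -> simple_perm j i = swap j i :> nat.
Proof.
move=> j_bd; rewrite /simple_perm /swap.
have e1 : @inord m j.-1 = j.-1 :> nat by rewrite inordK; lia.
have e2 : @inord m j = j :> nat by rewrite inordK; lia.
case: tpermP => [->|->|n1 n2]; rewrite ?e1 ?e2 ?eqxx //.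
  by case: eqP => // ?; lia.
case: eqP => [ei|_]; first by case: n1; apply/val_inj; rewrite /= e1.
by case: eqP => [ei|_] //; case: n2; apply/val_inj; rewrite /= e2.
Qed.

Lemma word_permE w (i : 'I_m.+1) : letters m w -> word_perm w i = act swap w i :> nat.
Proof.
rewrite /word_perm; elim: w i => [|j w IH] i /=; first by rewrite big_nil perm1.
by case/andP=> j_bd wm; rewrite big_cons permM IH // simple_permE.
Qed.

Lemma word_perm_cat w u : word_perm (w ++ u) = (word_perm w * word_perm u)%g.
Proof. by rewrite /word_perm big_cat. Qed.

Lemma word_perm_eq w u : letters m w -> letters m u ->
  word_perm w = word_perm u -> act f w =1 act f u.
Proof.
move=> wm um ewu; apply: (swap_faithful (ltnSn m) wm um _ fR) => x.
have [ltxm|lemx] := ltnP x m.+1.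
  by rewrite -[x]/(nat_of_ord (Ordinal ltxm)) -!word_permE // ewu.
by rewrite !(swap_letters_last (r := m)).
Qed.

(** The transpositions (0 y) generate, and (0 y+1) is the conjugate of (0 y) by
    an adjacent transposition. *)
Lemma word_perm_surj (s : {perm 'I_m.+1}) :
  exists w, letters m w && (word_perm w == s).
Proof.
pose S := [set simple_perm j | j : 'I_m.+1 & 0 < j].
have words_closed t : t \in <<S>>%g -> exists w, letters m w && (word_perm w == t).
  case/gen_prodgP => k [c cE ->]; elim: k c cE => [|k IH] c cE.
    by exists [::]; rewrite big_ord0 /word_perm big_nil eqxx.
  rewrite big_ord_recl; have [w /andP[wm /eqP <-]] := IH _ (fun i => cE (lift ord0 i)).
  have /imsetP[j] := cE ord0; rewrite inE => j_gt0 ->.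
  exists (val j :: w); rewrite /= j_gt0 -ltnS ltn_ord wm /=.
  by rewrite /word_perm big_cons.
apply: words_closed.
suff: [set: {perm 'I_m.+1}] \subset <<S>>%g by move/subsetP; apply; rewrite inE.
rewrite -(gen_tperm ord0) gen_subG; apply/subsetP => _ /imsetP[y _ ->].
have simple_in (j : 'I_m.+1) : 0 < j -> simple_perm j \in <<S>>%g.
  by move=> j_gt0; apply/mem_gen/imset_f; rewrite inE.
case: y => y ltym; elim: y ltym => [|y IH] ltym.
  by rewrite (_ : Ordinal ltym = ord0) ?tperm1 ?group1 //; apply: val_inj.
have y0G := IH (ltnW ltym); set y0 := Ordinal (ltnW ltym) in y0G *.
have := simple_in (Ordinal ltym) isT; rewrite /simple_perm /=.
rewrite (_ : inord y = y0); last by apply/val_inj; rewrite /= inordK // ltnW.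
rewrite (_ : inord y.+1 = Ordinal ltym); last by apply/val_inj; rewrite /= inordK.
move=> y1G.
(* The conjugation argument needs y distinct from 0. *)
have [y00|yn0] := eqVneq y0 ord0; first by rewrite -y00.
rewrite -[ord0](@tpermD _ y0 (Ordinal ltym)) // -{2}(tpermL y0 (Ordinal ltym)).
by rewrite -tpermJ groupJ.
Qed.

Definition perm_word (s : {perm 'I_m.+1}) : seq nat := xchoose (word_perm_surj s).

Lemma perm_wordP s : letters m (perm_word s) /\ word_perm (perm_word s) = s.
Proof. by have /andP[? /eqP] := xchooseP (word_perm_surj s). Qed.

Lemma coxeter_action : exists to : {action {perm 'I_m.+1} &-> T},
  (forall s, exists2 w, letters m w & to^~ s =1 act f w)
  /\ forall a b : 'I_m.+1, b = a.+1 :> nat -> to^~ (tperm a b) =1 f b.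
Proof.
pose to x s := act f (perm_word s) x.
have to1 : to^~ 1%g =1 id.
  have [wl wE] := perm_wordP 1%g; move=> x; rewrite /to.
  by rewrite (word_perm_eq wl (u := [::])) // wE /word_perm big_nil.
have toM x : act_morph to x.
  move=> a b; rewrite /to -act_cat.
  have [al aE] := perm_wordP a; have [bl bE] := perm_wordP b.
  have [abl abE] := perm_wordP (a * b)%g.
  have catl : letters m (perm_word a ++ perm_word b).
    by rewrite /letters all_cat; apply/andP.
  by apply: word_perm_eq; rewrite // word_perm_cat aE bE.
exists (TotalAction to1 toM); split=> [s | a b eb x].
  by exists (perm_word s); [have [] := perm_wordP s|].
have [wl wE] := perm_wordP (tperm a b); rewrite /= /to.
rewrite (word_perm_eq wl (u := [:: val b])) //=; first by rewrite eb /= -eb -ltnS ltn_ord.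
rewrite wE /word_perm big_seq1 /simple_perm inord_val; congr (tperm _ _).
by rewrite eb /= inord_val.
Qed.
End SymmetricAction.

(** * The symmetric group action by cluster R-matrices *)

Section ClusterCoxeter.

Variables (m n : nat) (n_gt1 : 1 < n).

Lemma clusterR_coxeter : coxeter_relations m (@clusterR m n).
Proof.
have R j : 0 < j < m -> _ := @clusterR_rmorphism m n n_gt1 j.
split=> [j j_bd | j j_gt0 ltj1m | j k j_gt0 ltj1k ltkm] f /=.
- have [T TR TE] := R j j_bd; rewrite -!TR.
  exact: (clusterR_rmorphism_involutive n_gt1 j_bd TE).
- have [|T TR TE] := R j; first by rewrite j_gt0 ltnW.
  have [|U UR UE] := R j.+1; first by [].
  by rewrite -!(TR, UR); apply: (clusterR_rmorphism_braid n_gt1 j_gt0 ltj1m TE UE).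
have j_bd : 0 < j < m by lia.
have k_bd : 0 < k < m by lia.
have [T TR TE] := R j j_bd; have [U UR UE] := R k k_bd.
have far : (j.+1 < k) || (k.+1 < j) by rewrite ltj1k.
rewrite -!(TR, UR).
exact: (clusterR_rmorphism_commute n_gt1 j_bd k_bd far TE UE).
Qed.

Lemma act_field_hom w : letters m.-1 w -> field_hom (act (@clusterR m n) w).
Proof.
rewrite /letters; elim: w => [_|j w IH] /=; first exact: field_hom_id.
case/andP=> j_bd /IH wh.
have [Rh _] := @clusterR_hom m n n_gt1 j ltac:(lia).
exact: (field_hom_comp wh Rh).
Qed.

End ClusterCoxeter.

Theorem theorem3p4 (m n : nat) (hm : (2 <= m)%N) (hn : (2 <= n)%N) :
  let R := @clusterR m n in
  [/\ forall j : nat, (1 <= j <= m - 1)%N ->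
        field_hom (R j) /\ forall v : var m n, R j (gen v) = Rvar j v,
      forall j : nat, (1 <= j <= m - 2)%N ->
        R j \o R j.+1 \o R j =1 R j.+1 \o R j \o R j.+1,
      forall j : nat, (1 <= j <= m - 1)%N -> R j \o R j =1 id,
      forall j k : nat, (1 <= j <= m - 1)%N -> (1 <= k <= m - 1)%N ->
        (j.+1 < k)%N || (k.+1 < j)%N -> R j \o R k =1 R k \o R j
    & exists to : {action {perm 'I_m} &-> ratfun m n},
        (forall s, field_hom (to^~ s)) /\
        forall a b : 'I_m, b = a.+1 :> nat -> to^~ (tperm a b) =1 R b].
Proof.
move=> R; have cox : coxeter_relations m R := clusterR_coxeter m hn.
split=> [j j_bd | j j_bd | j j_bd | j k j_bd k_bd far |].
- by apply: clusterR_hom => //; lia.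
- by apply: (cox_braid cox); lia.
- by apply: (cox_invol cox); lia.
- case/orP: far => far; first by apply: (cox_comm cox); lia.
  by move=> f; symmetry; apply: (cox_comm cox); lia.
case: m hm @R cox => [|m'] // _ R cox.
have [to [toW toR]] := coxeter_action cox.
exists to; split=> // s; have [w wl toE] := toW s.
have [wB [w1 wM]] := act_field_hom (m := m'.+1) hn wl.
split; first by move=> f g; rewrite !toE wB.
by split=> [|f g]; rewrite !toE ?w1 ?wM.
Qed.
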